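(* Let $\hat p_m$, $p_m$ ($1\le m\le M$), $K$, $\mathbf{N}=\mathbf{N}(n)$ and $\mathbf{h}=\mathbf{h}(n)$ satisfy all the assumptions listed in the context. Then $$\mathrm{MISE}[p^*,\hat p^*,\mathbf{N},\mathbf{h}]=\mathrm{AMISE}[p^*,\hat p^*;\mathbf{N},\mathbf{h}]+\mathcal{E}(\mathbf{N},\mathbf{h}),$$ where the leading term is $$\mathrm{AMISE}[p^*,\hat p^*;\mathbf{N},\mathbf{h}]=\frac{k_2^2}{4}\int_{\mathbb{R}}\Big(\sum_{m=1}^{M}h_m^2\,p_m''(x)\prod_{k\neq m}p_k(x)\Big)^2dx+\int_{\mathbb{R}}\Big(\sum_{m=1}^{M}\frac{p_m(x)}{N_mh_m}\prod_{k\neq m}p_k(x)^2\Big)dx\int_{\mathbb{R}}K^2(t)\,dt,$$ and the error term satisfies $$\mathcal{E}(\mathbf{N},\mathbf{h})=\mathcal{E}_b(\mathbf{N},\mathbf{h})+\mathcal{E}_V(\mathbf{N},\mathbf{h})=o\Big(\|\mathbf{h}\|^4+\frac{1}{\|\mathbf{N}\|\,\|\mathbf{h}\|}\Big)$$ as $n\to\infty$ (so that $\mathbf{h}\to0$, $\mathbf{N}\to\infty$ and $(\|\mathbf{N}\|\|\mathbf{h}\|)^{-1}\to0$). Here $$\mathcal{E}_b=\int_{\mathbb{R}}\big(\mathbb{E}[\hat p^*(x)]-p^*(x)\big)^2dx-\frac{k_2^2}{4}\int_{\mathbb{R}}\Big(\sum_{m=1}^{M}h_m^2p_m''(x)\prod_{k\neq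 m}p_k(x)\Big)^2dx,$$ $$\mathcal{E}_V=\int_{\mathbb{R}}\mathbb{V}[\hat p^*(x)]\,dx-\int_{\mathbb{R}}\Big(\sum_{m=1}^{M}\frac{p_m(x)}{N_mh_m}\prod_{k\neq m}p_k(x)^2\Big)dx\int_{\mathbb{R}}K^2(t)\,dt .$$
   Context: Fix an integer $M\ge1$ and probability densities $p_1,\dots,p_M$ on $\mathbb{R}$; put $p^*(x)=\prod_{m=1}^Mp_m(x)$. For each $m$ let $X^m_1,\dots,X^m_{N_m}$ be i.i.d. with density $p_m$, the samples for different $m$ being independent, and let $$\hat p_m(x)=\frac1{N_mh_m}\sum_{i=1}^{N_m}K\Big(\frac{x-X_i^m}{h_m}\Big),\qquad \hat p^*(x)=\prod_{m=1}^M\hat p_m(x),$$ with kernel $K$ and bandwidths $h_m>0$. Write $\mathbf{N}=(N_1,\dots,N_M)$, $\mathbf{h}=(h_1,\dots,h_M)$; $\|\cdot\|$ is a fixed norm on $\mathbb{R}^M$. $\mathbb{E}$ and $\mathbb{V}$ denote expectation and variance, and $$\mathrm{MISE}[p^*,\hat p^*,\mathbf{N},\mathbf{h}]=\mathbb{E}\int_{\mathbb{R}}(\hat p^*(x)-p^*(x))^2dx .$$ Assumptions: - Kernel: $0\le K\le C$ for some constant $C$, $\int K=1$, $\int tK(t)\,dt=0$, $\int K^2<\infty$, and $k_s:=\int_{\mathbb{R}}|t|^sK(t)\,dt<\infty$ for $s\in\{0,1,2,3\}$. - Densities: for each $m$, $p_m\in C^3(\mathbb{R})$, and $p_m^{(s)}$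 is bounded on $\mathbb{R}$ and integrable on $\mathbb{R}$ for each $s\in\{0,1,2,3\}$. - Scaling: $\mathbf{N}=\mathbf{N}(n)\in\mathbb{N}^M$ and $\mathbf{h}=\mathbf{h}(n)\in(0,\infty)^M$ are functions of $n\in\mathbb{N}$ such that for all $i$: $D_1\le N_i(n)/n\le D_2$ for some $0<D_1<D_2$; $A_1N_i(n)^{-\alpha_0}\le h_i(n)\le A_2N_i(n)^{-\alpha_0}$ for some $A_1,A_2>0$ and some $\alpha_0\in(0,1)$; and $\lim_{n\to\infty}h_i(n)N_i(n)=\infty$. *)

(* Defs.v *)
From HB Require Import structures.
From mathcomp Require Import all_boot all_order all_algebra.
From mathcomp Require Import all_classical all_reals all_analysis.

Set Implicit Arguments.
Unset Strict Implicit.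
Unset Printing Implicit Defensive.

Import Order.TTheory GRing.Theory Num.Theory.
Import numFieldNormedType.Exports.

Local Open Scope classical_set_scope.
Local Open Scope ring_scope.

Notation leb := lebesgue_measure.

Record is_norm (R : realType) (M : nat) (nrm : 'rV[R]_M -> R) : Prop := IsNorm {
  is_norm_ge0 : forall u, 0 <= nrm u;
  is_norm_eq0 : forall u, nrm u = 0 -> u = 0;
  is_normZ : forall (a : R) u, nrm (a *: u) = `|a| * nrm u;
  is_normD : forall u v, nrm (u + v) <= nrm u + nrm v }.

Record prob_density (R : realType) (f : R -> R) : Prop := ProbDensity {
  prob_density_measurable : measurable_fun [set: R] f;
  prob_density_ge0 : forall x, 0 <= f x;
  prob_density_int1 : (\int[leb]_x (f x)%:E = 1)%E }.

Definition has_density d (T : measurableType d) (R : realType)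
    (P : probability T R) (X : {RV P >-> R}) (f : R -> R) : Prop :=
  forall A : set R, measurable A ->
    (distribution P X A = \int[leb]_(x in A) (f x)%:E)%E.

Definition mutually_independent d (T : measurableType d) (R : realType)
    (P : probability T R) (I : finType) (X : I -> {RV P >-> R}) : Prop :=
  forall (J : {set I}) (A : I -> set R), (forall i, measurable (A i)) ->
    P (\bigcap_(i in [set` J]) (X i @^-1` A i)) =
    (\prod_(i in J) P (X i @^-1` A i))%E.

(* The M samples, the m-th one of size N m; the independence is joint, over all
   pairs (m, i), so it holds both within each sample and between samples. *)
Record independent_samples d (T : measurableType d) (R : realType)
    (P : probability T R) (M : nat) (p : 'I_M -> R -> R) (N : 'I_M -> nat)
    (X : forall m, 'I_(N m) -> {RV P >-> R}) : Prop := IndependentSamples {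
  samples_density : forall m i, has_density (X m i) (p m);
  samples_independent : mutually_independent
    (fun u : {m : 'I_M & 'I_(N m)} => X (tag u) (tagged u)) }.

Definition kernel_moment (R : realType) (K : R -> R) (s : nat) : \bar R :=
  (\int[leb]_t (`|t| ^+ s * K t)%:E)%E.

Record kernel_assumptions (R : realType) (K : R -> R) : Prop :=
  KernelAssumptions {
  kernel_measurable : measurable_fun [set: R] K;
  kernel_ge0 : forall t, 0 <= K t;
  kernel_bounded : exists C : R, forall t, K t <= C;
  kernel_int1 : (\int[leb]_t (K t)%:E = 1)%E;
  kernel_mean0 : (\int[leb]_t (t * K t)%:E = 0)%E;
  kernel_sqr : (\int[leb]_t (K t ^+ 2)%:E < +oo)%E;
  kernel_moments : forall s, (s <= 3)%N -> (kernel_moment K s < +oo)%E }.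

Record density_assumptions (R : realType) (f : R -> R) : Prop :=
  DensityAssumptions {
  density_prob : prob_density f;
  density_derivable : forall s x, (s < 3)%N -> derivable (derive1n s f) x 1;
  density_continuous : continuous (derive1n 3 f);
  density_bounded : forall s, (s <= 3)%N ->
    exists B : R, forall x, `|derive1n s f x| <= B;
  density_integrable : forall s, (s <= 3)%N ->
    leb.-integrable [set: R] (EFin \o derive1n s f) }.

(* The conditions are only imposed for n > 0, as they divide by n. *)
Record scaling_assumptions (R : realType) (M : nat)
    (N : nat -> 'I_M -> nat) (h : nat -> 'I_M -> R) : Prop :=
  ScalingAssumptions {
  scaling_h_gt0 : forall n i, (0 < n)%N -> 0 < h n i;
  scaling_N : exists D1 D2 : R, [/\ 0 < D1, D1 < D2 &
    forall n i, (0 < n)%N -> D1 <= (N n i)%:R / n%:R <= D2];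
  scaling_h : exists A1 A2 alpha0 : R, [/\ 0 < A1, 0 < A2, 0 < alpha0 < 1 &
    forall n i, (0 < n)%N ->
      A1 * (N n i)%:R `^ (- alpha0) <= h n i <= A2 * (N n i)%:R `^ (- alpha0)];
  scaling_hN : forall i, h n i * (N n i)%:R @[n --> \oo] --> +oo }.

Section Estimator.
Context d (T : measurableType d) (R : realType) (P : probability T R) (M : nat).
Context (K : R -> R) (p : 'I_M -> R -> R) (N : 'I_M -> nat) (h : 'I_M -> R).

Definition pstar (x : R) : R := \prod_(m < M) p m x.

Definition phat (m : 'I_M) (Y : 'I_(N m) -> {RV P >-> R}) (x : R) (w : T) : R :=
  ((N m)%:R * h m)^-1 * \sum_(i < N m) K ((x - Y i w) / h m).

Definition phatstar (X : forall m, 'I_(N m) -> {RV P >-> R}) (x : R) (w : T) : R :=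
  \prod_(m < M) phat (X m) x w.

Definition MISE (X : forall m, 'I_(N m) -> {RV P >-> R}) : \bar R :=
  (\int[P]_w \int[leb]_x ((phatstar X x w - pstar x) ^+ 2)%:E)%E.

Definition AMISE_bias : \bar R :=
  (kernel_moment K 2 ^+ 2 * (4^-1)%:E *
   \int[leb]_x ((\sum_(m < M) h m ^+ 2 * derive1n 2 (p m) x *
                   \prod_(k < M | k != m) p k x) ^+ 2)%:E)%E.

Definition AMISE_variance : \bar R :=
  ((\int[leb]_x (\sum_(m < M) p m x / ((N m)%:R * h m) *
                   \prod_(k < M | k != m) p k x ^+ 2)%:E) *
   \int[leb]_t (K t ^+ 2)%:E)%E.

Definition AMISE : \bar R := (AMISE_bias + AMISE_variance)%E.

Definition error_bias (X : forall m, 'I_(N m) -> {RV P >-> R}) : \bar R :=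
  (\int[leb]_x ('E_P[phatstar X x] - (pstar x)%:E) ^+ 2 - AMISE_bias)%E.

Definition error_variance (X : forall m, 'I_(N m) -> {RV P >-> R}) : \bar R :=
  (\int[leb]_x 'V_P[phatstar X x] - AMISE_variance)%E.

End Estimator.

(* Main.v *)
Require Import Defs.
From HB Require Import structures.
From mathcomp Require Import all_boot all_order all_algebra.
From mathcomp Require Import all_classical all_reals all_analysis.
From mathcomp Require Import measurable_realfun simple_functions ring lra.
Import Order.TTheory GRing.Theory Num.Theory.
Import numFieldNormedType.Exports.
Local Open Scope classical_set_scope.
Local Open Scope ring_scope.

Set Implicit Arguments.
Unset Strict Implicit.
Unset Printing Implicit Defensive.

(** At every point the mean squared error of the product estimator is its
    variance plus the square of its bias. All integrands are nonnegative, so by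
    Tonelli the MISE is the integral of the variance plus the integral of the
    squared bias ([MISE_bias_variance]), and the theorem reduces to expanding
    these two integrals with remainders integrable over the whole line.

    Independence gives closed forms. Let b_m be the mean of the m-th estimator,
    that is, p_m averaged against K at scale h_m, and let
    v_m = (N_m h_m)^-1 int K^2(t) p_m(x - h_m t) dt - b_m^2 / N_m be its
    variance. Expanding the products of sums and factoring the expectation of
    each monomial, the product estimator has mean prod_m b_m and second moment
    prod_m (b_m^2 + v_m) ([integral_phatstar], [integral_phatstar_sqr]).

    All functions are measured in the sup norm and in L1 simultaneously
    ([LinfL1_le]). In this scale sizes multiply: a function of size r times one
    of size r' has size r r', so squares of remainders are integrable with the
    expected order. The analytic input concerns translations. The second order
    Taylor remainder of p_m at x under translation by a is at most a^2 times
    the integral of |p_m'''| over [x - |a|, x + |a|] ([taylor_rem2_le]). That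
    local mass is at most 2 |a| sup |p_m'''|, and by Tonelli its integral in x
    is 2 |a| int |p_m'''|, so the remainder has size |a|^3. Averaging over the
    kernel, whose first moment vanishes, gives
    b_m = p_m + h_m^2 (k_2 / 2) p_m'' + O(h_m^3), and the cruder first order
    estimate gives int K^2(t) p_m(x - h_m t) dt = p_m int K^2 + O(h_m).

    Let eta = n^-alpha_0 and eps = 1 / (n eta). By the scaling assumptions h_m
    is of exact order eta and 1 / (N_m h_m) is O(eps). Expanding the products
    to first order ([uniO_prod_expansion]), the bias is its leading term, of
    size eta^2, plus O(eta^3), so the bias error is O(eta^5); the variance is
    its leading term plus O(eps (eps + eta)). All norms on a finite dimensional
    space being equivalent, the fourth power of the norm of h dominates eta^4
    and the inverse of the product of the norms of N and h dominates eps. As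
    eta and eps tend to 0, both errors are of smaller order. *)

(** * Integrals against a weight *)

Section integral_comparison.
Import HBNNSimple.

(** Identities between integrals of f(X) against a weight hold for every
    nonnegative f as soon as they hold for indicators: approximate f from below
    by simple functions. This serves twice, to pass from the law of a sample to
    its density and to factor the expectation of a product of independent
    variables one factor at a time. *)
Lemma ge0_integral_comp_mul_eq d1 (T1 : measurableType d1) d2
    (T2 : measurableType d2) (R : realType)
    (mu1 : {measure set T1 -> \bar R}) (mu2 : {measure set T2 -> \bar R})
    (X1 : T1 -> R) (X2 : T2 -> R) (g1 : T1 -> R) (g2 : T2 -> R) :
  measurable_fun setT X1 -> measurable_fun setT X2 ->
  measurable_fun setT g1 -> measurable_fun setT g2 ->
  (forall w, 0 <= g1 w) -> (forall w, 0 <= g2 w) ->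
  (forall B : set R, measurable B ->
     (\int[mu1]_w (\1_B (X1 w) * g1 w)%:E =
      \int[mu2]_w (\1_B (X2 w) * g2 w)%:E)%E) ->
  forall f : R -> R, measurable_fun setT f -> (forall x, 0 <= f x) ->
  (\int[mu1]_w (f (X1 w) * g1 w)%:E = \int[mu2]_w (f (X2 w) * g2 w)%:E)%E.
Proof.
move=> mX1 mX2 mg1 mg2 g10 g20 H f mf f0.
have mEf : measurable_fun setT (fun x : R => (f x)%:E) by exact/measurable_EFinP.
pose f_ := nnsfun_approx measurableT mEf.
suff key : forall d (T : measurableType d) (mu : {measure set T -> \bar R})
    (X : T -> R) (g : T -> R), measurable_fun setT X -> measurable_fun setT g ->
    (forall w, 0 <= g w) ->
    (\int[mu]_w (f (X w) * g w)%:E = limn (fun n => \sum_(k \in range (f_ n))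
      (k%:E * \int[mu]_w (\1_(f_ n @^-1` [set k]) (X w) * g w)%:E)))%E.
  rewrite (key _ _ mu1)// (key _ _ mu2)//; congr (limn _); apply/funext => n.
  by apply: eq_fsbigr => k _; rewrite H.
move=> d T mu X g mX mg g0.
have mfX n : measurable_fun setT (fun w => f_ n (X w)).
  by apply: (@measurableT_comp _ _ _ _ _ _ (f_ n)).
transitivity (limn (fun n => \int[mu]_w (f_ n (X w) * g w)%:E)%E).
  rewrite -monotone_convergence//.
  - apply: eq_integral => w _; apply/esym/cvg_lim => //.
    apply: cvg_EFin; first exact: nearW.
    apply: cvgMr_tmp.
    have := @cvg_nnsfun_approx _ _ _ _ measurableT _ mEf _ (X w) I.
    by move=> /(_ (fun x _ => f0 x))/fine_cvgP[].
  - by move=> n; apply/measurable_EFinP/measurable_funM.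
  - by move=> n w _; rewrite lee_fin mulr_ge0.
  - move=> w _ m n mn; rewrite lee_fin ler_wpM2r//.
    exact/lefP/nd_nnsfun_approx.
congr (limn _); apply/funext => n.
under eq_integral do rewrite fimfunE mulr_fsuml -fsumEFin//.
have mk k : measurable_fun setT (fun w => \1_(f_ n @^-1` [set k]) (X w) * g w).
  by apply: measurable_funM => //; apply: measurableT_comp.
rewrite ge0_integral_fsum//=.
- apply: eq_fsbigr => k /[!inE] -[x _ <-].
  under eq_integral do rewrite -mulrA EFinM.
  rewrite ge0_integralZl_EFin//; last exact/measurable_EFinP.
  by move=> w _; rewrite lee_fin mulr_ge0.
- move=> k; apply/measurable_EFinP.
  under eq_fun do rewrite -mulrA.
  exact: measurable_funM.
- move=> k w _; rewrite lee_fin mulr_ge0//.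
  exact: (nnfun_muleindic_ge0 (f_ n) k (X w)).
Qed.

End integral_comparison.

(** * Measurability, Tonelli and affine change of variables *)

Lemma measurable_fun_norm d (T : measurableType d) (R : realType) (f : T -> R) :
  measurable_fun setT f -> measurable_fun setT (fun t => `|f t|).
Proof. by move=> mf; apply: measurableT_comp. Qed.

Lemma measurable_fun_normE d (T : measurableType d) (R : realType) (f : T -> R) :
  measurable_fun setT f -> measurable_fun setT (fun t => `|f t|%:E).
Proof. by move=> mf; apply/measurable_EFinP; exact: measurable_fun_norm. Qed.

Lemma measurable_fun_EFin d (T : measurableType d) (R : realType) (f : T -> R) :
  measurable_fun setT f -> measurable_fun setT (fun t => (f t)%:E).
Proof. by move=> mf; exact/measurable_EFinP. Qed.

Lemma measurable_norm_exp (R : realType) k :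
  measurable_fun setT (fun t : R => `|t| ^+ k).
Proof.
apply: (@measurable_funX _ _ _ _ (fun t : R => `|t|)); exact: normr_measurable.
Qed.

Lemma fubini_tonelliR d1 d2 (T1 : measurableType d1) (T2 : measurableType d2)
    (R : realType) (m1 : {sigma_finite_measure set T1 -> \bar R})
    (m2 : {sigma_finite_measure set T2 -> \bar R}) (f : T1 -> T2 -> R) :
  measurable_fun setT (fun z : T1 * T2 => f z.1 z.2) ->
  (forall x y, 0 <= f x y) ->
  (\int[m1]_x \int[m2]_y (f x y)%:E = \int[m2]_y \int[m1]_x (f x y)%:E)%E.
Proof.
move=> mf f0; apply: (fubini_tonelli (fun z : T1 * T2 => (f z.1 z.2)%:E)).
- exact/measurable_EFinP.
- by move=> z; rewrite lee_fin.
Qed.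

Lemma measurable_integralR d1 d2 (T1 : measurableType d1)
    (T2 : measurableType d2) (R : realType)
    (m2 : {sigma_finite_measure set T2 -> \bar R}) (f : T1 -> T2 -> R) :
  measurable_fun setT (fun z : T1 * T2 => f z.1 z.2) ->
  (forall x y, 0 <= f x y) ->
  measurable_fun setT (fun x => \int[m2]_y (f x y)%:E)%E.
Proof.
move=> mf f0.
apply: (measurable_fun_fubini_tonelli_F (fun z : T1 * T2 => (f z.1 z.2)%:E)).
- exact/measurable_EFinP.
- by move=> z; rewrite lee_fin.
Qed.

(** The image of the Lebesgue measure under x |-> a + b x, multiplied by |b|,
    agrees with the Lebesgue measure on intervals, hence everywhere. Only
    measurability of f is available in the applications, so substitution rules
    for continuous integrands do not apply. *)
Lemma ge0_integral_affine (R : realType) (a b : R) (f : R -> R) :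
  b != 0 -> measurable_fun setT f -> (forall x, 0 <= f x) ->
  (\int[leb]_x (f x)%:E = `|b|%:E * \int[leb]_x (f (a + b * x))%:E)%E.
Proof.
move=> b0 mf f0; pose phi (x : measurableTypeR R) : measurableTypeR R := a + b * x.
have mphi : measurable_fun setT phi.
  by apply: measurable_funD => //; apply: measurable_funM.
have bp : 0 < `|b| by rewrite normr_gt0.
pose s : {nonneg R} := NngNum (ltW bp).
pose nu : {measure set (measurableTypeR R) -> \bar R} :=
  mscale s (pushforward (@lebesgue_measure R) phi).
rewrite (@eq_measure_integral _ _ _ setT (nu mphi)); last first.
  move=> A mA _; apply: lebesgue_measure_unique => // _ [[u v]] _ <-.
  suff pre : leb (`]u, v]%classic : set R) = (`|b|%:E *
      leb ([set x : R | (u < a + b * x <= v)%R]))%E.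
    by rewrite pre /nu /mscale/= /pushforward; congr (_ * leb _)%E.
  have : b < 0 \/ 0 < b by apply/orP; rewrite -neq_lt.
  case=> hb.
  - have -> : [set x : R | u < a + b * x <= v] = `[(v - a) / b, (u - a) / b[%classic.
      apply/seteqP; split => x /=; rewrite !in_itv/=;
      by rewrite ler_ndivrMr// ltr_ndivlMr// (mulrC x) ltrBlDl lerBrDl andbC.
    rewrite !lebesgue_measure_itv/= !lte_fin ltr_nM2r ?invr_lt0// ltrD2r.
    case: ifPn => _; last by rewrite mule0.
    rewrite -!EFinD -EFinM ltr0_norm//; congr EFin; field; lra.
  - have -> : [set x : R | u < a + b * x <= v] = `](u - a) / b, (v - a) / b]%classic.
      apply/seteqP; split => x /=; rewrite !in_itv/=;
      by rewrite ler_pdivlMr// ltr_pdivrMr// (mulrC x) ltrBlDl lerBrDl.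
    rewrite !lebesgue_measure_itv/= !lte_fin ltr_pM2r ?invr_gt0// ltrD2r.
    case: ifPn => _; last by rewrite mule0.
    rewrite -!EFinD -EFinM gtr0_norm//; congr EFin; field; lra.
rewrite ge0_integral_mscale//; first last.
- by move=> x _; rewrite lee_fin.
- exact/measurable_EFinP.
congr (_ * _)%E.
rewrite ge0_integral_pushforward//.
- exact/measurable_EFinP.
- by move=> x _; rewrite lee_fin.
Qed.

Lemma ge0_integral_shift (R : realType) (a : R) (f : R -> R) :
  measurable_fun setT f -> (forall x, 0 <= f x) ->
  (\int[leb]_x (f (a + x))%:E = \int[leb]_x (f x)%:E)%E.
Proof.
move=> mf f0; rewrite [RHS](@ge0_integral_affine _ a 1)// normr1 mul1e.
by under [RHS]eq_integral do rewrite mul1r.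
Qed.

(** * Local mass of a derivative *)

Lemma le_MVT0 (R : realType) (f df : R -> R) (b : R) :
  (forall y : R, is_derive y (1:R) f (df y)) ->
  exists2 c, `|c| <= `|b| & f b - f 0 = df c * b.
Proof.
move=> fdf.
have cf (x y : R) : {within `[x, y], continuous f}.
  apply: derivable_within_continuous => z _; exact: ex_derive.
have [b0|b0|->] := ltgtP b 0; last by exists 0; rewrite ?mulr0 ?subrr.
- have [c cb E] := MVT b0 (fun x _ => fdf x) (cf _ _).
  exists c; last by move: E; lra.
  by move: cb; rewrite in_itv/= => /andP[? ?]; rewrite !ltr0_norm//; lra.
- have [c cb E] := MVT b0 (fun x _ => fdf x) (cf _ _).
  exists c; last by move: E; lra.
  by move: cb; rewrite in_itv/= => /andP[? ?]; rewrite !gtr0_norm//; lra.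
Qed.

(** The mass of |g| on the interval of radius |a| around x. It dominates the
    increments of a primitive of g. Unlike the supremum of |g| over the same
    interval, its integral in x is controlled by the L1 norm of g. *)
Definition local_mass (R : realType) (g : R -> R) (a x : R) : \bar R :=
  (\int[leb]_(y in `[(x - `|a|)%R, (x + `|a|)%R]) `|g y|%:E)%E.

Lemma le_increment_local_mass (R : realType) (g : R -> R) (a b x : R) :
  (forall y, derivable g y 1) -> continuous (derive1 g) -> `|b| <= `|a| ->
  (`|g (x + b) - g x|%:E <= local_mass (derive1 g) a x)%E.
Proof.
move=> dg cg ba.
have mg : measurable_fun setT (fun y : R => `|derive1 g y|%:E).
  apply/measurable_EFinP/measurableT_comp => //; exact: continuous_measurable_fun.
have key u v : u <= v -> x - `|a| <= u -> v <= x + `|a| ->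
    (`|g v - g u|%:E <= local_mass (derive1 g) a x)%E.
  rewrite le_eqVlt => /predU1P[->|uv] xu vx.
    by rewrite subrr normr0; apply: integral_ge0 => y _; rewrite lee_fin.
  rewrite -[(`|g v - g u|)%:E]/(`|(g v - g u)%:E|)%E.
  have := @continuous_FTC2 _ (derive1 g) g u v uv.
  rewrite -EFinB => <-; last 3 first.
  - by apply: continuous_subspaceT.
  - have gc y : {for y, continuous g}.
      exact/differentiable_continuous/derivable1_diffP.
    by split => [y _ //||]; [apply/cvg_at_right_filter/gc|apply/cvg_at_left_filter/gc].
  - by [].
  apply: (le_trans (le_abse_integral _ _ _)) => //.
  - apply: measurable_funTS; apply/measurable_EFinP; exact: continuous_measurable_fun.
  apply: ge0_subset_integral => //.
  - exact: measurable_funTS.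
  - by apply: subset_itv; rewrite bnd_simp.
have [b0|b0] := leP 0 b.
- rewrite ger0_norm// in ba.
  by apply: key; rewrite ?lerDl// ?lerD2l// gerBl.
- rewrite ltr0_norm// in ba; rewrite distrC.
  by have := normr_ge0 a => a0; apply: key; lra.
Qed.

Lemma local_mass_le (R : realType) (g : R -> R) (a B x : R) :
  measurable_fun setT g -> (forall y, `|g y| <= B) ->
  (local_mass g a x <= (2 * `|a| * B)%:E)%E.
Proof.
move=> mg gB; rewrite /local_mass.
apply: (@le_trans _ _ (\int[leb]_(y in `[(x - `|a|)%R, (x + `|a|)%R]) (cst B%:E y))%E).
  apply: ge0_le_integral => //.
  - by apply: measurable_funTS; apply/measurable_EFinP/measurableT_comp.
  - by move=> y _; rewrite lee_fin.
rewrite integral_cst//= lebesgue_measure_itv/= lte_fin.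
case: ifPn => _; last by rewrite mule0 lee_fin !mulr_ge0// (le_trans _ (gB 0)).
by rewrite -EFinB -EFinM lee_fin; lra.
Qed.

(** Writing the constraint on y as a function of y - x puts the local mass in
    a form symmetric in x and y, suited to Tonelli. *)
Lemma local_mass_fubiniE (R : realType) (g : R -> R) (a x : R) :
  local_mass g a x =
  (\int[leb]_y (\1_`[- `|a|, `|a|] (y - x) * `|g y|)%:E)%E.
Proof.
rewrite /local_mass integral_mkcond; apply: eq_integral => y _.
rewrite patchE indicE.
have -> : (y \in `[x - `|a|, x + `|a|]%classic) = (y - x \in `[- `|a|, `|a|]%classic).
  by apply/idP/idP; rewrite !inE/= !in_itv/=; lra.
by case: ifPn => _; rewrite ?mul1r ?mul0r.
Qed.

Lemma measurable_local_mass_kernel (R : realType) (g : R -> R) (a : R) :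
  measurable_fun setT g ->
  measurable_fun setT (fun z : R * R =>
    \1_`[- `|a|, `|a|] (z.2 - z.1) * `|g z.2|).
Proof.
move=> mg; apply/measurable_funM.
- apply: (@measurableT_comp _ _ _ _ _ _ (\1_`[- `|a|, `|a|] : R -> R)) => //.
  by apply: measurable_funB.
- by do 2 apply: measurableT_comp => //.
Qed.

Lemma measurable_local_mass (R : realType) (g : R -> R) (a : R) :
  measurable_fun setT g -> measurable_fun setT (local_mass g a).
Proof.
move=> mg; rewrite (funext (local_mass_fubiniE g a)).
apply: (@measurable_integralR _ _ _ _ _ lebesgue_measure (fun x y : R =>
  \1_`[- `|a|, `|a|] (y - x) * `|g y|)); first exact: measurable_local_mass_kernel.
by move=> *; rewrite mulr_ge0.
Qed.

(** Each y is counted for the x at distance at most |a| from it, a set of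
    measure 2 |a|. *)
Lemma integral_local_mass (R : realType) (g : R -> R) (a : R) :
  measurable_fun setT g ->
  (\int[leb]_x local_mass g a x = (2 * `|a|)%:E * \int[leb]_x `|g x|%:E)%E.
Proof.
move=> mg; under eq_integral do rewrite local_mass_fubiniE.
transitivity (\int[leb]_y \int[leb]_x
    (\1_`[(- `|a|)%R, `|a|%R] (y - x) * `|g y|)%:E)%E.
  apply: (@fubini_tonelliR _ _ _ _ _ lebesgue_measure lebesgue_measure
    (fun x y => \1_`[- `|a|, `|a|] (y - x) * `|g y|)).
  - exact: measurable_local_mass_kernel.
  - by move=> *; rewrite mulr_ge0.
rewrite -ge0_integralZl_EFin//; first last.
  by apply/measurable_EFinP/measurableT_comp.
apply: eq_integral => y _.
transitivity (\int[leb]_(x in `[(y - `|a|)%R, (y + `|a|)%R]) (cst `|g y|%:E x))%E.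
  rewrite [RHS]integral_mkcond; apply: eq_integral => x _.
  rewrite patchE indicE.
  have -> : (y - x \in `[- `|a|, `|a|]%classic) = (x \in `[y - `|a|, y + `|a|]%classic).
    by apply/idP/idP; rewrite !inE/= !in_itv/=; lra.
  by case: ifPn => _; rewrite ?mul1r ?mul0r.
rewrite integral_cst//= lebesgue_measure_itv/= lte_fin.
case: ifPn => h; first by rewrite -EFinB -!EFinM; congr EFin; lra.
have -> : `|a| = 0 by move: (normr_ge0 a) h; lra.
by rewrite mulr0 mul0e mule0.
Qed.

(** * Simultaneous sup and L1 bounds *)

(** A single constant bounds the sup norm and the L1 norm: one factor of a
    product is estimated in sup norm, the other in L1, without having to decide
    in advance which is which. *)
Definition LinfL1_le (R : realType) (f : R -> R) (c : R) : Prop :=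
  [/\ measurable_fun setT f, forall x, `|f x| <= c &
      (\int[leb]_x `|f x|%:E <= c%:E)%E].

Lemma LinfL1_le_ge0 (R : realType) (f : R -> R) c : LinfL1_le f c -> 0 <= c.
Proof. by case=> _ /(_ 0) fc _; exact: le_trans fc. Qed.

Lemma LinfL1_leW (R : realType) (f : R -> R) c c' :
  c <= c' -> LinfL1_le f c -> LinfL1_le f c'.
Proof.
move=> cc' [mf fc intf]; split=> // [x|]; first exact: le_trans (fc x) cc'.
by apply: le_trans intf _; rewrite lee_fin.
Qed.

Lemma LinfL1_le_integrable (R : realType) (f : R -> R) c :
  LinfL1_le f c -> leb.-integrable setT (fun x => (f x)%:E).
Proof.
case=> mf _ intf; apply/integrableP; split; first exact/measurable_EFinP.
exact: le_lt_trans intf (ltry _).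
Qed.

Lemma LinfL1_le_of_le (R : realType) (f g : R -> R) c :
  measurable_fun setT f -> (forall x, `|f x| <= `|g x|) ->
  LinfL1_le g c -> LinfL1_le f c.
Proof.
move=> mf fg [mg gc intg]; split=> // [x|]; first exact: le_trans (fg x) (gc x).
apply: le_trans intg; apply: ge0_le_integral => //.
- by apply/measurable_EFinP/measurableT_comp.
- by apply/measurable_EFinP/measurableT_comp.
- by move=> x _; rewrite lee_fin.
Qed.

Lemma LinfL1_leZ (R : realType) (f : R -> R) a c :
  LinfL1_le f c -> LinfL1_le (fun x => a * f x) (`|a| * c).
Proof.
move=> [mf fc intf]; split=> [|x|]; first exact: measurable_funM.
  by rewrite normrM ler_wpM2l.
under eq_integral do rewrite normrM EFinM.
rewrite ge0_integralZl_EFin//; last by apply/measurable_EFinP/measurableT_comp.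
by rewrite EFinM lee_pmul// integral_ge0.
Qed.

Lemma LinfL1_leD (R : realType) (f g : R -> R) c c' :
  LinfL1_le f c -> LinfL1_le g c' -> LinfL1_le (fun x => f x + g x) (c + c').
Proof.
move=> [mf fc intf] [mg gc intg]; split=> [|x|]; first exact: measurable_funD.
  exact: le_trans (ler_normD _ _) (lerD _ _).
have mf' : measurable_fun setT (fun x : R => `|f x|%:E).
  by apply/measurable_EFinP/measurableT_comp.
have mg' : measurable_fun setT (fun x : R => `|g x|%:E).
  by apply/measurable_EFinP/measurableT_comp.
apply: (@le_trans _ _ (\int[leb]_x (`|f x|%:E + `|g x|%:E))%E).
  apply: ge0_le_integral => //.
  - by apply/measurable_EFinP/measurableT_comp => //; exact: measurable_funD.
  - exact: emeasurable_funD.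
  - by move=> x _; rewrite -EFinD lee_fin ler_normD.
by rewrite ge0_integralD// EFinD leeD.
Qed.

Lemma LinfL1_leM (R : realType) (f g : R -> R) c b :
  LinfL1_le f c -> measurable_fun setT g -> (forall x, `|g x| <= b) ->
  LinfL1_le (fun x => g x * f x) (b * c).
Proof.
move=> f_le mg gb; have b0 : 0 <= b := le_trans (normr_ge0 _) (gb 0).
have := LinfL1_leZ b f_le; rewrite ger0_norm//.
apply: LinfL1_le_of_le; first by case: f_le => mf _ _; exact: measurable_funM.
by move=> x; rewrite !normrM (ger0_norm b0) ler_wpM2r.
Qed.

(** Averaging preserves sizes: if translations by a cost B |a|^k in both
    norms, averaging over a = h t with weight W costs B h^k times the k-th
    moment of W. The L1 part exchanges the integrals over x and t. The cases
    k = 0, 1, 3 are used. *)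
Lemma LinfL1_le_smoothing (R : realType) (W : R -> R) (D : R -> R -> R)
    (k : nat) (B h w : R) :
  measurable_fun setT W -> (forall t, 0 <= W t) ->
  (\int[leb]_t (`|t| ^+ k * W t)%:E <= w%:E)%E ->
  measurable_fun setT (fun z : R * R => D z.1 z.2) ->
  (forall a, LinfL1_le (D a) (B * `|a| ^+ k)) -> 0 < h ->
  (forall x, leb.-integrable setT (fun t => (W t * D (h * t) x)%:E)) /\
  LinfL1_le (fun x => \int[leb]_t (W t * D (h * t) x)) (B * h ^+ k * w).
Proof.
move=> mW W0 Ww mD DB h0.
have B0 : 0 <= B by have := LinfL1_le_ge0 (DB 1); rewrite normr1 expr1n mulr1.
have mWD : measurable_fun setT (fun z : R * R => W z.2 * D (h * z.2) z.1).
  apply: measurable_funM; first exact: measurableT_comp.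
  apply: (@measurableT_comp _ _ _ _ _ _ (fun z : R * R => D z.1 z.2) _
    (fun z : R * R => (h * z.2, z.1))) => //.
  apply: measurable_fun_pair => //.
  exact: (@measurable_funM _ _ _ _ (cst h) snd).
have mWDx x : measurable_fun setT (fun t => W t * D (h * t) x).
  exact: (measurable_fun_pair2 x mWD).
pose c := B * h ^+ k; have c0 : 0 <= c by rewrite mulr_ge0// exprn_ge0// ltW.
have bnd : (\int[leb]_t (c * (`|t| ^+ k * W t))%:E <= (c * w)%:E)%E.
  under eq_integral do rewrite EFinM.
  rewrite ge0_integralZl_EFin//.
  - by rewrite (EFinM c w); apply: lee_wpmul2l; rewrite ?lee_fin.
  - by move=> t _; rewrite lee_fin mulr_ge0// exprn_ge0.
  - apply/measurable_EFinP/measurable_funM => //.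
    exact: measurable_norm_exp.
have mc : measurable_fun setT (fun t : R => (c * (`|t| ^+ k * W t))%:E).
  apply/measurable_EFinP/measurable_funM => //; apply/measurable_funM => //.
  exact: measurable_norm_exp.
have bx x : (\int[leb]_t `|W t * D (h * t) x|%:E <= (c * w)%:E)%E.
  apply: le_trans bnd; apply: ge0_le_integral => //.
  - exact: (measurable_fun_normE (mWDx x)).
  - move=> t _; rewrite lee_fin normrM (ger0_norm (W0 t)).
    case: (DB (h * t)) => _ /(_ x) + _; rewrite normrM (gtr0_norm h0) exprMn => Dx.
    have -> : c * (`|t| ^+ k * W t) = W t * (B * (h ^+ k * `|t| ^+ k)).
      by rewrite /c; ring.
    exact: ler_wpM2l.
have iWD x : leb.-integrable setT (fun t => (W t * D (h * t) x)%:E).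
  apply/integrableP; split; first exact: (measurable_fun_EFin (mWDx x)).
  exact: le_lt_trans (bx x) (ltry _).
split => //.
have rle x : (`|\int[leb]_t (W t * D (h * t) x)|%:E <=
              \int[leb]_t `|W t * D (h * t) x|%:E)%E.
  rewrite EFin_normr_Rintegral//; last exact: iWD.
  by apply: le_abse_integral => //; exact: (measurable_fun_EFin (mWDx x)).
have mr : measurable_fun setT (fun x => \int[leb]_t (W t * D (h * t) x)).
  pose f z : \bar R := (W z.2 * D (h * z.2) z.1)%:E.
  have mf : measurable_fun setT f := measurable_fun_EFin mWD.
  have mpos : measurable_fun setT (fubini_F lebesgue_measure f^\+%E).
    by apply: measurable_fun_fubini_tonelli_F => //; exact: measurable_funepos.
  have mneg : measurable_fun setT (fubini_F lebesgue_measure f^\-%E).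
    by apply: measurable_fun_fubini_tonelli_F => //; exact: measurable_funeneg.
  have mI : measurable_fun setT (fun x => \int[leb]_t (W t * D (h * t) x)%:E)%E.
    rewrite (_ : (fun x => _) =
        (fubini_F lebesgue_measure f^\+ \- fubini_F lebesgue_measure f^\-)%E).
      exact: emeasurable_funB.
    by apply/funext => y; rewrite integralE /fubini_F !unlock.
  exact: (measurableT_comp (fine_measurable measurableT) mI).
split=> // [x|]; first by rewrite -lee_fin (le_trans (rle x)).
apply: (@le_trans _ _ (\int[leb]_x \int[leb]_t `|W t * D (h * t) x|%:E)%E).
  apply: ge0_le_integral => //.
  - exact: (measurable_fun_normE mr).
  - apply: (@measurable_integralR _ _ _ _ _ lebesgue_measure
      (fun x t => `|W t * D (h * t) x|)) => //.
    exact: (measurable_fun_norm mWD).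
(* The bound on D is an integral over x for fixed t. *)
rewrite (_ : (\int[leb]_x \int[leb]_t `|W t * D (h * t) x|%:E)%E =
    (\int[leb]_t \int[leb]_x `|W t * D (h * t) x|%:E)%E); last first.
  apply: (@fubini_tonelliR _ _ _ _ _ lebesgue_measure lebesgue_measure
      (fun x t => `|W t * D (h * t) x|)) => //.
  exact: (measurable_fun_norm mWD).
apply: le_trans bnd; apply: ge0_le_integral => //.
- by move=> t _; apply: integral_ge0.
- apply: (@measurable_integralR _ _ _ _ _ lebesgue_measure
      (fun t x => `|W t * D (h * t) x|)) => //.
  have := measurableT_comp mWD (@measurable_swap _ _ R R).
  by move=> /measurable_fun_norm mWD'; exact: mWD'.
- move=> t _; case: (DB (h * t)) => mDt _ Dt.
  under eq_integral do rewrite normrM EFinM.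
  rewrite ge0_integralZl_EFin//; last exact: (measurable_fun_normE mDt).
  apply: le_trans (lee_wpmul2l _ Dt) _; first by rewrite lee_fin.
  rewrite -EFinM lee_fin (ger0_norm (W0 t)) normrM (gtr0_norm h0) exprMn.
  rewrite (_ : c * (`|t| ^+ k * W t) = W t * (B * (h ^+ k * `|t| ^+ k))) //.
  by rewrite /c; ring.
Qed.

(** * Taylor remainders under translation *)

(** Turns a pointwise bound by a multiple of the local mass of g into a bound
    in both norms. *)
Lemma LinfL1_le_local_mass (R : realType) (f g : R -> R) (a b B : R) :
  measurable_fun setT f -> 0 <= b -> LinfL1_le g B ->
  (forall x, (`|f x|%:E <= b%:E * local_mass g a x)%E) ->
  LinfL1_le f (b * (2 * `|a| * B)).
Proof.
move=> mf b0 [mg gB intg] fg; split=> // [x|].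
  rewrite -lee_fin EFinM; apply: le_trans (fg x) _.
  by apply: lee_wpmul2l; [rewrite lee_fin|exact: local_mass_le].
have mm := measurable_local_mass a mg.
have m0 x : (0 <= local_mass g a x)%E by apply: integral_ge0.
apply: (@le_trans _ _ (\int[leb]_x (b%:E * local_mass g a x))%E).
  apply: ge0_le_integral => //.
  - exact: (measurable_fun_normE mf).
  - exact: measurable_funeM.
rewrite ge0_integralZl_EFin// [leRHS]EFinM; apply: lee_wpmul2l; first by rewrite lee_fin.
rewrite integral_local_mass// [leRHS]EFinM; apply: lee_wpmul2l.
  by rewrite lee_fin mulr_ge0.
by [].
Qed.

Lemma LinfL1_le_shift (R : realType) (f : R -> R) (a B : R) :
  LinfL1_le f B -> LinfL1_le (fun x => f (x - a)) B.
Proof.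
move=> [mf fB intf]; split=> // [|].
  by apply: (measurableT_comp mf); exact: measurable_funB.
have := @ge0_integral_shift R (- a) (fun x => `|f x|) (measurable_fun_norm mf)
  (fun=> normr_ge0 _).
by under eq_integral do rewrite addrC; move=> ->.
Qed.

Lemma LinfL1_le_increment (R : realType) (g : R -> R) (a B : R) :
  measurable_fun setT g ->
  (forall y, derivable g y 1) -> continuous (derive1 g) ->
  LinfL1_le (derive1 g) B ->
  LinfL1_le (fun x => g (x - a) - g x) (2 * B * `|a|).
Proof.
move=> mg dg cg gB.
rewrite (_ : 2 * B * `|a| = 1 * (2 * `|a| * B)); last by ring.
apply: LinfL1_le_local_mass gB _ => //.
- apply: measurable_funB => //.
  by apply: (measurableT_comp mg); exact: measurable_funB.
- by move=> x; rewrite mul1e; apply: le_increment_local_mass; rewrite ?normrN.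
Qed.

(** The remainder in the expansion of a |-> g (x - a) to second order at 0,
    as a function of the translation a and the base point x. *)
Definition taylor_rem2 (R : realType) (g : R -> R) (a x : R) : R :=
  g (x - a) - g x + a * derive1n 1 g x - a ^+ 2 / 2 * derive1n 2 g x.

(** As a function of a the remainder vanishes at 0 together with its first
    derivative, and its second derivative g''(x - a) - g''(x) is an increment
    of g'', bounded by the local mass of g'''. Two applications of the mean
    value theorem cost a factor |a| each. *)
Lemma taylor_rem2_le (R : realType) (g : R -> R) (a x : R) :
  (forall s y, (s < 3)%N -> derivable (derive1n s g) y 1) ->
  continuous (derive1n 3 g) ->
  (`|taylor_rem2 g a x|%:E <= (a ^+ 2)%:E * local_mass (derive1n 3 g) a x)%E.
Proof.
move=> dg cg.
have shiftd s y : (s < 3)%N ->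
    is_derive (y : R) (1 : R) (fun b => derive1n s g (x - b))
      (- derive1n s.+1 g (x - y)).
  move=> s3; have /derivableP H := dg s (x - y) s3.
  rewrite -derive1E in H.
  have := @is_derive1_comp _ (derive1n s g) (fun b : R => x - b) y _ (-1) H _.
  rewrite /comp derive1nS mulrN1; apply.
  by apply: is_derive_eq; rewrite add0r mul1r.
pose f1 (b : R) := - derive1n 1 g (x - b) + derive1n 1 g x - b * derive1n 2 g x.
have df0 y : is_derive (y : R) (1 : R) (fun b => taylor_rem2 g b x) (f1 y).
  rewrite /taylor_rem2; have := shiftd 0%N y isT; rewrite derive1n0 => H.
  apply: is_derive_eq; rewrite /f1 /GRing.scale/=.
  by field.
have df1 y : is_derive (y : R) (1 : R) f1 (derive1n 2 g (x - y) - derive1n 2 g x).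
  rewrite /f1; have H := shiftd 1%N y isT.
  apply: is_derive_eq; rewrite /f1 /GRing.scale/=.
  by field.
have f00 : taylor_rem2 g 0 x = 0 by rewrite /taylor_rem2 subr0 expr0n/=; ring.
have f10 : f1 0 = 0 by rewrite /f1 subr0; ring.
have [c ca] := le_MVT0 a df0; rewrite f00 subr0 => ->.
have [c' cc'] := le_MVT0 c df1; rewrite f10 subr0 => ->.
rewrite -mulrA mulrC normrM EFinM.
apply: lee_pmul; rewrite ?lee_fin//.
  by rewrite normrM -(real_normK (num_real a)) expr2 ler_wpM2r.
apply: le_increment_local_mass.
- by move=> y; exact: dg.
- by rewrite -derive1nS.
- by rewrite normrN (le_trans cc').
Qed.

(** One constant serves all derivatives up to order 3 and both norms, which
    keeps the later constants simple. *)
Lemma density_LinfL1 (R : realType) (p : R -> R) : density_assumptions p ->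
  exists B, forall s, (s <= 3)%N -> LinfL1_le (derive1n s p) B.
Proof.
move=> hp.
have one s : (s <= 3)%N -> exists B, LinfL1_le (derive1n s p) B.
  move=> s3; have [B pB] := density_bounded hp s3.
  have /integrableP[mp ip] := density_integrable hp s3.
  have mp' : measurable_fun setT (derive1n s p) by exact/measurable_EFinP.
  pose I := (\int[leb]_x `|derive1n s p x|%:E)%E.
  have Ifin : I \is a fin_num by rewrite ge0_fin_numE// integral_ge0.
  exists (Num.max B (fine I)); split=> // [x|].
    by rewrite (le_trans (pB x))// le_max lexx.
  by rewrite -/I -(fineK Ifin) lee_fin le_max lexx orbT.
have [B0 H0] := one 0%N isT; have [B1 H1] := one 1%N isT.
have [B2 H2] := one 2%N isT; have [B3 H3] := one 3%N isT.
have b0 := LinfL1_le_ge0 H0; have b1 := LinfL1_le_ge0 H1.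
have b2 := LinfL1_le_ge0 H2; have b3 := LinfL1_le_ge0 H3.
exists (B0 + B1 + B2 + B3) => -[|[|[|[|//]]]] _.
- by apply: LinfL1_leW H0; lra.
- by apply: LinfL1_leW H1; lra.
- by apply: LinfL1_leW H2; lra.
- by apply: LinfL1_leW H3; lra.
Qed.

Lemma measurable_shift2 (R : realType) (f : R -> R) : measurable_fun setT f ->
  measurable_fun setT (fun z : R * R => f (z.2 - z.1)).
Proof.
by move=> mf; apply: (measurableT_comp mf); exact: measurable_funB.
Qed.

Lemma measurable_taylor_rem2 (R : realType) (g : R -> R) :
  (forall s, (s <= 2)%N -> measurable_fun setT (derive1n s g)) ->
  measurable_fun setT (fun z : R * R => taylor_rem2 g z.1 z.2).
Proof.
move=> mg; have m s : (s <= 2)%N ->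
    measurable_fun setT (fun z : R * R => derive1n s g z.2).
  by move=> /mg m; exact: (measurableT_comp m (@measurable_snd _ _ R R)).
apply: measurable_funB; first apply: measurable_funD; first apply: measurable_funB.
- exact: measurable_shift2 (mg 0%N isT).
- exact: m 0%N isT.
- exact: measurable_funM (@measurable_fst _ _ R R) (m 1%N isT).
- apply: measurable_funM (m 2%N isT); apply: measurable_funM => //.
  exact: measurable_funX (@measurable_fst _ _ R R).
Qed.

Lemma LinfL1_le_taylor_rem2 (R : realType) (p : R -> R) (B a : R) :
  density_assumptions p -> (forall s, (s <= 3)%N -> LinfL1_le (derive1n s p) B) ->
  LinfL1_le (taylor_rem2 p a) (2 * B * `|a| ^+ 3).
Proof.
move=> hp pB.
rewrite (_ : 2 * B * `|a| ^+ 3 = a ^+ 2 * (2 * `|a| * B)); last first.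
  by rewrite -(real_normK (num_real a)); ring.
apply: LinfL1_le_local_mass (pB 3%N isT) _; last 2 first.
- by rewrite exprn_even_ge0.
- move=> x; apply: taylor_rem2_le; first exact: density_derivable.
  exact: density_continuous.
- apply: (measurable_fun_pair2 (f := fun z : R * R => taylor_rem2 p z.1 z.2)).
  by apply: measurable_taylor_rem2 => s s2; case: (pB s (leqW s2)).
Qed.

(** * Products of functions of independent variables *)

(** The defining property of a density, stated for measurable sets, extends to
    integrals. *)
Lemma integral_has_density d (T : measurableType d) (R : realType)
    (P : probability T R) (X : {RV P >-> R}) (f phi : R -> R) :
  prob_density f -> has_density X f ->
  measurable_fun setT phi -> (forall y, 0 <= phi y) ->
  (\int[P]_w (phi (X w))%:E = \int[leb]_y (phi y * f y)%:E)%E.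
Proof.
move=> fd Xf mphi phi0; have mX : measurable_fun setT X by [].
transitivity (\int[P]_w (phi (X w) * 1)%:E)%E.
  by apply: eq_integral => w _; rewrite mulr1.
apply: (@ge0_integral_comp_mul_eq _ _ _ _ _ P lebesgue_measure X id (cst 1) f) => //.
- exact: prob_density_measurable.
- exact: prob_density_ge0.
- move=> B mB; transitivity (distribution P X B).
    under eq_integral do rewrite mulr1.
    rewrite (_ : (fun w => _) = (fun w => (\1_(X @^-1` B) w)%:E)) //.
    rewrite integral_indic ?setIT// -[X in measurable X]setTI; exact: mX.
  rewrite Xf// [LHS]integral_mkcond; apply: eq_integral => y _.
  by rewrite patchE indicE; case: ifPn => _; rewrite ?mul1r ?mul0r.
Qed.

Lemma measurable_prod_pred d (T : measurableType d) (R : realType)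
    (I : finType) (Q : pred I) (f : I -> T -> R) :
  (forall i, measurable_fun setT (f i)) ->
  measurable_fun setT (fun w => \prod_(i | Q i) f i w).
Proof.
move=> mf; under eq_fun do rewrite -big_filter.
by apply: measurable_prod => i _; exact: mf.
Qed.

Lemma measurable_sum_pred d (T : measurableType d) (R : realType)
    (I : finType) (Q : pred I) (f : I -> T -> R) :
  (forall i, measurable_fun setT (f i)) ->
  measurable_fun setT (fun w => \sum_(i | Q i) f i w).
Proof.
move=> mf; under eq_fun do rewrite -big_filter.
by apply: measurable_sum => i; exact: mf.
Qed.

(** For indicator functions this is the definition of independence. The
    general case follows by replacing the indicators one index at a time by
    arbitrary functions: with the other factors fixed, both sides are integrals
    of the new factor against a weight, and they agree on indicators. *)
Lemma mutually_independent_expectation_prod d (T : measurableType d)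
    (R : realType) (P : probability T R) (I : finType) (X : I -> {RV P >-> R})
    (phi : I -> R -> R) (e : I -> R) :
  mutually_independent X ->
  (forall u, measurable_fun setT (phi u)) -> (forall u y, 0 <= phi u y) ->
  (forall u, (\int[P]_w (phi u (X u w))%:E = (e u)%:E)%E) ->
  (\int[P]_w (\prod_u phi u (X u w))%:E = (\prod_u e u)%:E)%E.
Proof.
move=> indX; have mX u : measurable_fun setT (X u) by [].
have mpre u A : measurable A -> measurable (X u @^-1` A).
  by move=> mA; rewrite -[X in measurable X]setTI; exact: mX.
have E1 u A : measurable A ->
    (\int[P]_w (\1_A (X u w))%:E = (fine (P (X u @^-1` A)))%:E)%E.
  move=> mA; rewrite (_ : (fun w => _) = (fun w => (\1_(X u @^-1` A) w)%:E)) //.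
  by rewrite integral_indic ?setIT ?fineK ?fin_num_measure//; exact: mpre.
(* Outside s the factors are indicators; s = [::] is the hypothesis. *)
suff H (s : seq I) : forall (phi : I -> R -> R) (e : I -> R),
    (forall u, measurable_fun setT (phi u)) -> (forall u y, 0 <= phi u y) ->
    (forall u, (\int[P]_w (phi u (X u w))%:E = (e u)%:E)%E) ->
    (forall u, u \notin s -> exists2 A : set R, measurable A & phi u = \1_A) ->
    (\int[P]_w (\prod_u phi u (X u w))%:E = (\prod_u e u)%:E)%E.
  move=> mphi phi0 phie; apply: (H (enum I)) => // u.
  by rewrite mem_enum.
elim: s => {phi e} [|v s IHs] phi e mphi phi0 phie phiA.
  have /boolp.choice[A AP] : forall u, exists A : set R,
      measurable A /\ phi u = \1_A.
    by move=> u; have [A mA AE] := phiA u isT; exists A.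
  have mA u : measurable (A u) by case: (AP u).
  transitivity (P (\bigcap_(i in [set` [set: I]%SET]) (X i @^-1` A i))).
    rewrite (_ : (fun w => _) = (fun w =>
      (\1_(\bigcap_(i in [set` [set: I]%SET]) (X i @^-1` A i)) w)%:E)).
      rewrite integral_indic ?setIT//; apply: fin_bigcap_measurable => //.
      by move=> i _; exact: mpre.
    apply/funext => w; congr EFin; rewrite indicE.
    case: (boolP (w \in _)) => [|/negP]; rewrite inE => h.
      rewrite big1// => u _; have [_ ->] := AP u.
      by rewrite indicE mem_set//; apply: (h u); rewrite /= inE.
    have [u hu] : exists u, ~ A u (X u w).
      by apply/existsNP => h'; apply: h => u _; exact: h'.
    rewrite (bigD1 u)//=; have [_ ->] := AP u.
    by rewrite indicE memNset// mul0r.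
  rewrite indX// -prodEFin; apply: eq_big => [u|u _]; first by rewrite inE.
  rewrite -phie; have [_ ->] := AP u; rewrite E1// fineK// fin_num_measure//.
  exact: mpre.
pose c := \prod_(u | u != v) e u.
have e0 u : 0 <= e u.
  by rewrite -lee_fin -phie integral_ge0// => w _; rewrite lee_fin.
have c0 : 0 <= c by apply: prodr_ge0.
have mcomp (psi : R -> R) u : measurable_fun setT psi ->
    measurable_fun setT (fun w => psi (X u w)).
  by move=> mpsi; apply: (measurableT_comp mpsi).
transitivity (\int[P]_w (phi v (X v w) * \prod_(u | u != v) phi u (X u w))%:E)%E.
  by apply: eq_integral => w _; rewrite (bigD1 v).
rewrite (@ge0_integral_comp_mul_eq _ _ _ _ _ P P (X v) (X v) _ (cst c))//.
- under eq_integral do rewrite mulrC EFinM.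
  rewrite ge0_integralZl_EFin//.
  + by rewrite phie -EFinM [in RHS](bigD1 v)//= mulrC.
  + by move=> w _; rewrite lee_fin.
  + by apply: measurable_fun_EFin; exact: mcomp.
- by apply: measurable_prod_pred => u; exact: mcomp.
- by move=> w; apply: prodr_ge0.
move=> B mB.
(* Replacing the factor of v by an indicator gives back the case of s. *)
pose phi' u := if u == v then \1_B : R -> R else phi u.
pose e' u := if u == v then fine (P (X v @^-1` B)) else e u.
transitivity (\int[P]_w (\prod_u phi' u (X u w))%:E)%E.
  apply: eq_integral => w _; rewrite [in RHS](bigD1 v)//= {1}/phi' eqxx.
  by congr (_ * _)%:E; apply: eq_bigr => u /negbTE uv; rewrite /phi' uv.
rewrite (IHs phi' e').
- rewrite (bigD1 v)//= {1}/e' eqxx.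
  have -> : \prod_(i | i != v) e' i = c.
    by apply: eq_bigr => u /negbTE uv; rewrite /e' uv.
  under [RHS]eq_integral do rewrite mulrC EFinM.
  rewrite ge0_integralZl_EFin//.
  + by rewrite E1// -EFinM mulrC.
  + by apply: measurable_fun_EFin; apply: mcomp.
- by move=> u; rewrite /phi'; case: ifP.
- by move=> u y; rewrite /phi'; case: ifP.
- by move=> u; rewrite /phi' /e'; case: ifPn => // /eqP ->; exact: E1.
- move=> u us; rewrite /phi'; have [_|uv] := eqVneq u v; first by exists B.
  by apply: phiA; rewrite inE negb_or uv.
Qed.

(** The indices are partitioned into blocks by t, and each block carries a sum
    of monomials in its own variables. Distributing the product over the sums
    gives monomials indexed by the choice f of one term per block, whose
    expectations factor; distributing backwards gives the product of the block
    expectations. This yields the factorization over blocks without introducing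
    joint laws. *)
Lemma expectation_prod_sum_blocks d (T : measurableType d) (R : realType)
    (P : probability T R) (I B J : finType) (t : I -> B) (Q : B -> pred J)
    (X : I -> {RV P >-> R}) (g : J -> I -> R -> R) (e : J -> I -> R) :
  mutually_independent X ->
  (forall j u, measurable_fun setT (g j u)) -> (forall j u y, 0 <= g j u y) ->
  (forall j u, (\int[P]_w (g j u (X u w))%:E = (e j u)%:E)%E) ->
  (\int[P]_w (\prod_b \sum_(j | Q b j) \prod_(u | t u == b) g j u (X u w))%:E =
   (\prod_b \sum_(j | Q b j) \prod_(u | t u == b) e j u)%:E)%E.
Proof.
move=> indX mg g0 ge.
have regroup (F : J -> I -> R) :
    \prod_b \sum_(j | Q b j) \prod_(u | t u == b) F j u =
    \sum_(f <- [seq f <- index_enum {ffun B -> J} | f \in family Q])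
      \prod_u F (f (t u)) u.
  rewrite big_filter bigA_distr_big_dep; apply: eq_bigr => f _.
  rewrite [RHS](partition_big t predT)//=; apply: eq_bigr => b _.
  by apply: eq_bigr => u /eqP ->.
under eq_integral do rewrite regroup -sumEFin.
rewrite regroup -sumEFin ge0_integral_sum//.
- apply: eq_bigr => f _.
  exact: (mutually_independent_expectation_prod (phi := fun u => g (f (t u)) u)).
- move=> f; apply: measurable_fun_EFin; apply: measurable_prod_pred => u.
  by apply: (measurableT_comp (mg _ _)).
- by move=> f w _; rewrite lee_fin; apply: prodr_ge0.
Qed.

Lemma big_tag_eq (R : nzRingType) (M : nat) (N : 'I_M -> nat)
    (F : {m : 'I_M & 'I_(N m)} -> R) (m : 'I_M) :
  \sum_(u | tag u == m) F u = \sum_(i < N m) F (Tagged (fun m => 'I_(N m)) i).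
Proof.
transitivity (\sum_(b | b == m) \sum_(i < N b) F (Tagged (fun m => 'I_(N m)) i)).
  rewrite (sig_big_dep _ (fun b => xpredT)
    (fun b i => F (Tagged (fun m => 'I_(N m)) i))).
  by apply: eq_big => [[b i]|[b i]] //=; rewrite andbT.
by rewrite big_pred1_eq.
Qed.

Lemma prod_if_eq (R : comNzRingType) (I : finType) (Q : pred I) (j : I)
    (F : I -> R) : Q j ->
  \prod_(u | Q u) (if j == u then F u else 1) = F j.
Proof.
move=> Qj; rewrite (bigD1 j)//= eqxx big1 ?mulr1// => u /andP[_ /negbTE uj].
by rewrite eq_sym uj.
Qed.

Section sample_moments.
Context d (T : measurableType d) (R : realType) (P : probability T R).
Context (M : nat) (N : 'I_M -> nat) (X : forall m, 'I_(N m) -> {RV P >-> R}).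
Arguments X : clear implicits.
Context (k : 'I_M -> R -> R) (a q : 'I_M -> R).
Hypothesis indX : mutually_independent
  (fun u : {m : 'I_M & 'I_(N m)} => X (tag u) (tagged u)).
Hypothesis mk : forall m, measurable_fun setT (k m).
Hypothesis k0 : forall m y, 0 <= k m y.
Hypothesis ka : forall m i, (\int[P]_w (k m (X m i w))%:E = (a m)%:E)%E.
Hypothesis kq : forall m i, (\int[P]_w (k m (X m i w) ^+ 2)%:E = (q m)%:E)%E.

Let U := {m : 'I_M & 'I_(N m)}.

Let int1 : (\int[P]_w 1%:E = 1%:E)%E.
Proof. by have := @expectation_cst _ _ _ P (1 : R); rewrite unlock. Qed.

(** The block of m is the m-th sample, and the terms of its sum are single
    variables: g j u is the kernel at u = j and 1 elsewhere. *)
Lemma expectation_prod_sum_sample :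
  (\int[P]_w (\prod_m \sum_(i < N m) k m (X m i w))%:E =
   (\prod_m ((N m)%:R * a m))%:E)%E.
Proof.
pose g (j u : U) (y : R) := if j == u then k (tag u) y else 1.
pose e (j u : U) := if j == u then a (tag u) else 1.
have H := @expectation_prod_sum_blocks _ _ _ P U _ U tag (fun m j => tag j == m)
  _ g e indX.
transitivity (\int[P]_w (\prod_b \sum_(j : U | tag j == b)
    \prod_(u | tag u == b) g j u (X (tag u) (tagged u) w))%:E)%E.
  apply: eq_integral => w _; congr EFin; apply: eq_bigr => m _.
  rewrite -(big_tag_eq (fun u => k (tag u) (X (tag u) (tagged u) w))).
  by apply: eq_bigr => j jm; rewrite prod_if_eq.
rewrite H.
- congr EFin; apply: eq_bigr => m _.
  transitivity (\sum_(j : U | tag j == m) a m).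
    by apply: eq_bigr => j jm; rewrite prod_if_eq// (eqP jm).
  by rewrite (big_tag_eq (fun=> a m)) big_const_ord iter_addr_0 mulr_natl.
- by move=> j u; rewrite /g; case: (j == u).
- by move=> j u y; rewrite /g; case: (j == u).
- by move=> j u; rewrite /g /e; case: (j == u).
Qed.

(** The square of each sum is a sum over pairs (j1, j2) of indices of the
    sample. The N m diagonal pairs contribute q m and the others a m ^+ 2,
    whence N^2 a^2 + N (q - a^2). *)
Lemma expectation_prod_sum_sample_sqr :
  (\int[P]_w ((\prod_m \sum_(i < N m) k m (X m i w)) ^+ 2)%:E =
   (\prod_m ((N m)%:R ^+ 2 * a m ^+ 2 + (N m)%:R * (q m - a m ^+ 2)))%:E)%E.
Proof.
pose g1 (j u : U) (y : R) := if j == u then k (tag u) y else 1.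
pose g (j : U * U) u y := g1 j.1 u y * g1 j.2 u y.
pose e (j : U * U) (u : U) :=
  if j.1 == j.2 then (if j.1 == u then q (tag u) else 1)
  else (if j.1 == u then a (tag u) else 1) * (if j.2 == u then a (tag u) else 1).
have H := @expectation_prod_sum_blocks _ _ _ P U _ (U * U)%type tag
  (fun m j => (tag j.1 == m) && (tag j.2 == m)) _ g e indX.
transitivity (\int[P]_w (\prod_b \sum_(j : U * U | (tag j.1 == b) && (tag j.2 == b))
    \prod_(u | tag u == b) g j u (X (tag u) (tagged u) w))%:E)%E.
  apply: eq_integral => w _; congr EFin; rewrite -prodrXl; apply: eq_bigr => m _.
  rewrite -(big_tag_eq (fun u => k (tag u) (X (tag u) (tagged u) w))).
  rewrite expr2 big_distrlr/= pair_big/=.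
  apply: eq_bigr => j /andP[j1m j2m].
  by rewrite big_split/= !prod_if_eq.
rewrite H.
- congr EFin; apply: eq_bigr => m _.
  rewrite -(pair_big (fun j => tag j == m) (fun j => tag j == m)
    (fun j1 j2 => \prod_(u | tag u == m) e (j1, j2) u))/=.
  transitivity (\sum_(j1 : U | tag j1 == m)
      ((N m)%:R * a m ^+ 2 + (q m - a m ^+ 2))); last first.
    by rewrite (big_tag_eq (fun=> _)) big_const_ord iter_addr_0 -mulr_natl; ring.
  apply: eq_bigr => j1 j1m.
  transitivity (\sum_(j2 : U | tag j2 == m)
      (a m ^+ 2 + if j1 == j2 then q m - a m ^+ 2 else 0)).
    apply: eq_bigr => j2 j2m; rewrite /e/=; case: eqVneq => [_|_].
      by rewrite prod_if_eq// (eqP j1m) addrC subrK.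
    by rewrite big_split/= !prod_if_eq// (eqP j1m) (eqP j2m) addr0 expr2.
  rewrite big_split/= (big_tag_eq (fun=> _)) big_const_ord iter_addr_0.
  congr (_ + _); first by rewrite mulr_natl.
  rewrite (bigD1 j1)//= eqxx big1 ?addr0// => u /andP[_ /negbTE uj].
  by rewrite eq_sym uj.
- by move=> j u; apply: measurable_funM; rewrite /g1; case: (_ == u).
- by move=> j u y; rewrite /g /g1; apply: mulr_ge0; case: (_ == u).
- move=> [j1 j2] u; rewrite /g /g1 /e/=; case: (eqVneq j1 j2) => [->|].
    case: (j2 == u); last by under eq_integral do rewrite mulr1.
    by under eq_integral do rewrite -expr2.
  move=> j12; case: (eqVneq j1 u) => [E1|_]; case: (eqVneq j2 u) => [E2|_].
  + by rewrite E1 E2 eqxx in j12.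
  + by rewrite mulr1; under eq_integral do rewrite mulr1.
  + by rewrite mul1r; under eq_integral do rewrite mul1r.
  + by rewrite mul1r.
Qed.

End sample_moments.

(** * Mean and variance of the product estimator *)

(** Used with c the mean, for the variance, and with c the target value, for
    the mean squared error. *)
Lemma integral_sqrB d (T : measurableType d) (R : realType)
    (P : probability T R) (Y : T -> R) (e s c : R) :
  measurable_fun setT Y -> (forall w, 0 <= Y w) ->
  (\int[P]_w (Y w)%:E = e%:E)%E -> (\int[P]_w (Y w ^+ 2)%:E = s%:E)%E ->
  (\int[P]_w ((Y w - c) ^+ 2)%:E = (s - 2 * c * e + c ^+ 2)%:E)%E.
Proof.
move=> mY Y0 Ye Ys.
have i1 : P.-integrable setT (fun w => (Y w)%:E).
  apply/integrableP; split; first exact: measurable_fun_EFin.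
  by under eq_integral do rewrite gee0_abs ?lee_fin//; rewrite Ye ltry.
have i2 : P.-integrable setT (fun w => (Y w ^+ 2)%:E).
  apply/integrableP; split; first exact/measurable_fun_EFin/measurable_funX.
  by under eq_integral do rewrite gee0_abs ?lee_fin ?sqr_ge0//; rewrite Ys ltry.
have ic : P.-integrable setT (fun=> (c ^+ 2)%:E).
  exact: finite_measure_integrable_cst.
have i1' : P.-integrable setT (fun w => (- (2 * c))%:E * (Y w)%:E)%E.
  exact: integrableZl.
transitivity (\int[P]_w ((Y w ^+ 2)%:E + (- (2 * c))%:E * (Y w)%:E + (c ^+ 2)%:E))%E.
  by apply: eq_integral => w _; rewrite -EFinM -!EFinD; congr EFin; ring.
rewrite integralD//=; last exact: integrableD.
rewrite integralD//= integralZl// Ye Ys integral_cst//= probability_setT mule1.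
by rewrite -EFinM -!EFinD; congr EFin; ring.
Qed.

Definition kernel_smooth (R : realType) (W p : R -> R) (h x : R) : R :=
  \int[leb]_t (W t * p (x - h * t)).

(** The substitution y = x - h t turns the expectation into an average of f
    over a window of width h; it is applied with W = K and W = K^2. *)
Lemma integral_kernel_sample d (T : measurableType d) (R : realType)
    (P : probability T R) (Y : {RV P >-> R}) (W f : R -> R) (h x B w : R) :
  prob_density f -> has_density Y f -> LinfL1_le f B ->
  measurable_fun setT W -> (forall t, 0 <= W t) ->
  (\int[leb]_t (W t)%:E <= w%:E)%E -> 0 < h ->
  (\int[P]_z (W ((x - Y z) / h))%:E = (h * kernel_smooth W f h x)%:E)%E.
Proof.
move=> fd Yf fB mW W0 Ww h0.
have [iWf _] := @LinfL1_le_smoothing R W (fun a x => f (x - a)) 0 B h w mW W0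
  ltac:(by under eq_integral do rewrite expr0 mul1r)
  (measurable_shift2 (prob_density_measurable fd))
  ltac:(by move=> a; rewrite expr0 mulr1; exact: LinfL1_le_shift) h0.
have mphi : measurable_fun setT (fun y : R => W ((x - y) / h)).
  by apply: (measurableT_comp mW); apply: measurable_funM => //; exact: measurable_funB.
rewrite (integral_has_density fd Yf mphi)//.
rewrite (@ge0_integral_affine _ x (- h)) ?oppr_eq0 ?gt_eqF//; last 2 first.
- by apply: measurable_funM => //; exact: prob_density_measurable.
- by move=> y; rewrite mulr_ge0// prob_density_ge0.
rewrite normrN gtr0_norm// EFinM; congr (_ * _)%E.
rewrite /kernel_smooth /Rintegral fineK; last exact: integrable_fin_num.
apply: eq_integral => t _; rewrite mulNr; congr (W _ * _)%:E.
by field; rewrite gt_eqF.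
Qed.

Definition phatstar_mean (R : realType) (M : nat) (K : R -> R)
    (p : 'I_M -> R -> R) (h : 'I_M -> R) (x : R) : R :=
  \prod_m kernel_smooth K (p m) (h m) x.

Section estimator_moments.
Context (R : realType) (d : measure_display) (T : measurableType d).
Context (P : probability T R) (M : nat) (K : R -> R) (hK : kernel_assumptions K).
Context (p : 'I_M -> R -> R) (hp : forall m, density_assumptions (p m)).
Context (N : 'I_M -> nat) (h : 'I_M -> R).
Context (X : forall m, 'I_(N m) -> {RV P >-> R}).
Arguments X : clear implicits.
Hypothesis N0 : forall m, (0 < N m)%N.
Hypothesis h0 : forall m, 0 < h m.
Hypothesis hX : independent_samples p X.

Let b m x := kernel_smooth K (p m) (h m) x.
Let s m x := kernel_smooth (fun t => K t ^+ 2) (p m) (h m) x.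

(** The variance of the m-th kernel estimator at x: the second moment of a
    single normalized summand divided by N, minus the square of the mean divided by N. *)
Definition kde_variance (m : 'I_M) (x : R) : R :=
  ((N m)%:R * h m)^-1 * s m x - (N m)%:R^-1 * b m x ^+ 2.

Let Nh m : (N m)%:R * h m != 0.
Proof. by rewrite mulf_neq0// ?gt_eqF// ltr0n. Qed.

Let mK := kernel_measurable hK.

Let phatstarE x w : phatstar K h X x w =
  (\prod_m ((N m)%:R * h m)^-1) * \prod_m \sum_(i < N m) K ((x - X m i w) / h m).
Proof. by rewrite -big_split. Qed.

Let K2_fin : exists w : R, (\int[leb]_t (K t ^+ 2)%:E <= w%:E)%E.
Proof.
exists (fine (\int[leb]_t (K t ^+ 2)%:E)%E); rewrite fineK//.
rewrite ge0_fin_numE; first exact: kernel_sqr.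
by apply: integral_ge0 => t _; rewrite lee_fin sqr_ge0.
Qed.

Let ka x m i : (\int[P]_w (K ((x - X m i w) / h m))%:E = (h m * b m x)%:E)%E.
Proof.
have [B pB] := density_LinfL1 (hp m).
apply: (@integral_kernel_sample _ _ _ _ _ K _ _ _ B 1) => //.
- exact: density_prob.
- exact: samples_density hX _ _.
- exact: pB 0%N isT.
- exact: kernel_ge0.
- by rewrite kernel_int1.
Qed.

Let kq x m i : (\int[P]_w (K ((x - X m i w) / h m) ^+ 2)%:E = (h m * s m x)%:E)%E.
Proof.
have [B pB] := density_LinfL1 (hp m); have [w K2w] := K2_fin.
apply: (@integral_kernel_sample _ _ _ _ _ (fun t => K t ^+ 2) _ _ _ B w) => //.
- exact: density_prob.
- exact: samples_density hX _ _.
- exact: pB 0%N isT.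
- exact: measurable_funX.
- by move=> t; exact: sqr_ge0.
Qed.

Let mk x m : measurable_fun setT (fun y : R => K ((x - y) / h m)).
Proof.
by apply: (measurableT_comp mK); apply: measurable_funM => //; exact: measurable_funB.
Qed.

Let c := \prod_m ((N m)%:R * h m)^-1.

Let prod_gt0 x w : 0 <= \prod_m \sum_(i < N m) K ((x - X m i w) / h m).
Proof. by apply: prodr_ge0 => m _; apply: sumr_ge0 => i _; exact: kernel_ge0. Qed.

Let mprod x :
  measurable_fun setT (fun w => \prod_m \sum_(i < N m) K ((x - X m i w) / h m)).
Proof.
apply: measurable_prod_pred => m; apply: measurable_sum_pred => i.
by apply: (measurableT_comp (mk x m)).
Qed.

Let c0 : 0 <= c.
Proof.
by apply: prodr_ge0 => m _; rewrite invr_ge0 mulr_ge0// ?ler0n// ltW.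
Qed.

Lemma integral_phatstar x :
  (\int[P]_w (phatstar K h X x w)%:E = (phatstar_mean K p h x)%:E)%E.
Proof.
rewrite /phatstar_mean.
under eq_integral do rewrite phatstarE EFinM.
rewrite ge0_integralZl_EFin//; last 2 first.
- by move=> w _; rewrite lee_fin.
- exact: (measurable_fun_EFin (mprod x)).
rewrite (expectation_prod_sum_sample (k := fun m y => K ((x - y) / h m))
  (samples_independent hX) (mk x) (fun _ _ => kernel_ge0 hK _) (ka x)).
rewrite -EFinM -big_split/=; congr EFin; apply: eq_bigr => m _.
by rewrite (mulrA (N m)%:R) mulKf.
Qed.

Lemma integral_phatstar_sqr x :
  (\int[P]_w (phatstar K h X x w ^+ 2)%:E =
   (\prod_m (b m x ^+ 2 + kde_variance m x))%:E)%E.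
Proof.
under eq_integral do rewrite phatstarE exprMn EFinM.
rewrite ge0_integralZl_EFin//; last 3 first.
- by move=> w _; rewrite lee_fin sqr_ge0.
- exact: (measurable_fun_EFin (measurable_funX 2 (mprod x))).
- by rewrite sqr_ge0.
rewrite (expectation_prod_sum_sample_sqr (k := fun m y => K ((x - y) / h m))
  (samples_independent hX) (mk x) (fun _ _ => kernel_ge0 hK _) (ka x) (kq x)).
rewrite -EFinM -prodrXl -big_split/=; congr EFin; apply: eq_bigr => m _.
rewrite /kde_variance; have := Nh m; rewrite mulf_eq0 negb_or => /andP[? ?].
by field; apply/andP.
Qed.

Let phatstar_ge0 x w : 0 <= phatstar K h X x w.
Proof. by rewrite phatstarE mulr_ge0. Qed.

Let measurable_phatstar x : measurable_fun setT (phatstar K h X x).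
Proof.
rewrite (funext (phatstarE x)); exact: measurable_funM.
Qed.

Lemma expectation_phatstar x : 'E_P[phatstar K h X x]%E = (phatstar_mean K p h x)%:E.
Proof. by rewrite unlock integral_phatstar. Qed.

Definition phatstar_variance x : R :=
  \prod_m (b m x ^+ 2 + kde_variance m x) - \prod_m (b m x ^+ 2).

Lemma variance_phatstar x : 'V_P[phatstar K h X x]%E = (phatstar_variance x)%:E.
Proof.
rewrite /variance unlock expectation_phatstar unlock /=.
rewrite (integral_sqrB _ (measurable_phatstar x) (phatstar_ge0 x)
  (integral_phatstar x) (integral_phatstar_sqr x)).
by rewrite /phatstar_variance /phatstar_mean prodrXl; congr EFin; ring.
Qed.

Let mb m : measurable_fun setT (b m).
Proof.
have [B pB] := density_LinfL1 (hp m).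
have [_ []] // := @LinfL1_le_smoothing R K (fun a x => p m (x - a)) 0 B (h m) 1 mK
  (kernel_ge0 hK)
  ltac:(by under eq_integral do rewrite expr0 mul1r; rewrite kernel_int1)
  (measurable_shift2 (prob_density_measurable (density_prob (hp m))))
  ltac:(by move=> a; rewrite expr0 mulr1; apply: LinfL1_le_shift; exact: pB 0%N isT)
  (h0 m).
Qed.

Lemma phatstar_variance_ge0 x : 0 <= phatstar_variance x.
Proof. by rewrite -lee_fin -variance_phatstar variance_ge0. Qed.

(** After exchanging expectation and integral by Tonelli, this is the pointwise
    decomposition of the mean squared error. *)
Lemma MISE_bias_variance :
  measurable_fun setT phatstar_variance ->
  MISE K p h X = (\int[leb]_x (phatstar_variance x)%:E +
    \int[leb]_x ((phatstar_mean K p h x - pstar p x) ^+ 2)%:E)%E.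
Proof.
move=> mV; rewrite /MISE.
have mp m : measurable_fun setT (p m).
  exact: prob_density_measurable (density_prob (hp m)).
have mps : measurable_fun setT (pstar p) by exact: measurable_prod_pred.
have mpb : measurable_fun setT (phatstar_mean K p h).
  exact: (@measurable_prod_pred _ _ _ _ xpredT b).
transitivity (\int[leb]_x \int[P]_w ((phatstar K h X x w - pstar p x) ^+ 2)%:E)%E.
  apply: (@fubini_tonelliR _ _ _ _ _ P lebesgue_measure
    (fun w x => (phatstar K h X x w - pstar p x) ^+ 2)); last first.
    by move=> w x; exact: sqr_ge0.
  apply: measurable_funX; apply: measurable_funB; last first.
    exact: (measurableT_comp mps (@measurable_snd _ _ T R)).
  apply: measurable_prod_pred => m; apply: measurable_funM => //.
  apply: measurable_sum_pred => i; apply: (measurableT_comp mK).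
  apply: measurable_funM => //; apply: measurable_funB => //.
  by apply: (@measurableT_comp _ _ _ _ _ _ (X m i)).
rewrite -ge0_integralD//; first last.
- by apply: measurable_fun_EFin; apply: measurable_funX; exact: measurable_funB.
- by move=> x _; rewrite lee_fin sqr_ge0.
- exact: measurable_fun_EFin.
- by move=> x _; rewrite lee_fin phatstar_variance_ge0.
apply: eq_integral => x _.
rewrite (integral_sqrB _ (measurable_phatstar x) (phatstar_ge0 x)
  (integral_phatstar x) (integral_phatstar_sqr x)) -EFinD.
by rewrite /phatstar_variance /phatstar_mean prodrXl; congr EFin; ring.
Qed.

End estimator_moments.

(** * Uniform orders of magnitude for sequences of functions *)

(** F n is of order r n in sup norm and in L1, uniformly in n > 0. These classes
    form a calculus in which the remainders are tracked by their rates only. *)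
Definition uniO (R : realType) (r : nat -> R) (F : nat -> R -> R) : Prop :=
  exists C, forall n, (0 < n)%N -> LinfL1_le (F n) (C * r n).

(** Uniform boundedness without integrability: empty products equal 1, so the
    products over k != m that occur below need not lie in any class [uniO]. *)
Definition uniB (R : realType) (F : nat -> R -> R) : Prop :=
  exists C, forall n, (0 < n)%N ->
    measurable_fun setT (F n) /\ forall x, `|F n x| <= C.

Section uniform_classes.
Context (R : realType).
Implicit Types (r : nat -> R) (F G : nat -> R -> R).

Lemma eq_uniO r F G : (forall n, (0 < n)%N -> F n =1 G n) -> uniO r F -> uniO r G.
Proof.
move=> FG [C FC]; exists C => n n0.
by rewrite -(funext (FG n n0)); exact: FC.
Qed.

Lemma uniO_weaken r r' (A : R) F :
  (forall n, (0 < n)%N -> 0 <= r n <= A * r' n) -> uniO r F -> uniO r' F.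
Proof.
move=> rr' [C FC]; exists (Num.max C 0 * A) => n n0.
apply: LinfL1_leW (FC n n0); have /andP[r0 rA] := rr' n n0.
apply: (@le_trans _ _ (Num.max C 0 * r n)); first by rewrite ler_wpM2r// le_max lexx.
by rewrite -mulrA ler_wpM2l// le_max lexx orbT.
Qed.

Lemma uniO_D r F G : uniO r F -> uniO r G -> uniO r (fun n x => F n x + G n x).
Proof.
move=> [C FC] [C' GC]; exists (C + C') => n n0; rewrite mulrDl.
by apply: LinfL1_leD; [exact: FC|exact: GC].
Qed.

Lemma uniO_scale r r' F (a : nat -> R) (A : R) :
  (forall n, (0 < n)%N -> `|a n| <= A * r' n) -> uniO r F ->
  uniO (fun n => r' n * r n) (fun n x => a n * F n x).
Proof.
move=> aA [C FC]; exists (A * C) => n n0.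
apply: LinfL1_leW (LinfL1_leZ (a n) (FC n n0)).
have Cr := LinfL1_le_ge0 (FC n n0).
rewrite (_ : A * C * (r' n * r n) = A * r' n * (C * r n)); last by ring.
by rewrite ler_wpM2r// aA.
Qed.

Lemma uniO_cst r F (a : R) : uniO r F -> uniO r (fun n x => a * F n x).
Proof.
move=> [C FC]; exists (`|a| * C) => n n0; rewrite -mulrA.
exact: LinfL1_leZ (FC n n0).
Qed.

Lemma uniO_N r F : uniO r F -> uniO r (fun n x => - F n x).
Proof. by move=> /(uniO_cst (-1)); apply: eq_uniO => n _ x; rewrite mulN1r. Qed.

Lemma uniO_B r F G : uniO r F -> uniO r G -> uniO r (fun n x => F n x - G n x).
Proof. by move=> FO /uniO_N; exact: uniO_D. Qed.

Lemma uniO_0 r : (forall n, (0 < n)%N -> 0 <= r n) -> uniO r (fun _ _ => 0).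
Proof.
move=> r0; exists 0 => n n0; rewrite mul0r; split => [|x|].
- exact: measurable_cst.
- by rewrite normr0.
- by under eq_integral do rewrite normr0; rewrite integral0.
Qed.

Lemma uniO_sum r (I : Type) (s : seq I) (Q : pred I) (F : I -> nat -> R -> R) :
  (forall n, (0 < n)%N -> 0 <= r n) -> (forall i, uniO r (F i)) ->
  uniO r (fun n x => \sum_(i <- s | Q i) F i n x).
Proof.
move=> r0 FO; elim: s => [|i s IHs].
  by apply: eq_uniO (uniO_0 r0) => n _ x; rewrite big_nil.
case Qi: (Q i).
  by apply: eq_uniO (uniO_D (FO i) IHs) => n _ x; rewrite big_cons Qi.
by apply: eq_uniO IHs => n _ x; rewrite big_cons Qi.
Qed.

Lemma uniO_uniB r F : (forall n, (0 < n)%N -> 0 <= r n <= 1) -> uniO r F -> uniB F.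
Proof.
move=> r1 [C FC]; exists (Num.max C 0) => n n0; have [mF Fb _] := FC n n0.
split=> // x; apply: (le_trans (Fb x)); have /andP[r0 rn1] := r1 n n0.
apply: (@le_trans _ _ (Num.max C 0 * r n)); first by rewrite ler_wpM2r// le_max lexx.
by rewrite ler_piMr// le_max lexx orbT.
Qed.

Lemma uniO_mulB r F G : uniO r F -> uniB G -> uniO r (fun n x => G n x * F n x).
Proof.
move=> [C FC] [C' GC]; exists (C' * C) => n n0; rewrite -mulrA.
by have [mG Gb] := GC n n0; apply: LinfL1_leM (FC n n0) mG Gb.
Qed.

Lemma uniO_mul r r' F G : uniO r F -> uniO r' G ->
  uniO (fun n => r' n * r n) (fun n x => G n x * F n x).
Proof.
move=> [C FC] [C' GC]; exists (C' * C) => n n0.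
rewrite (_ : C' * C * (r' n * r n) = (C' * r' n) * (C * r n)); last by ring.
by have [mG Gb _] := GC n n0; apply: LinfL1_leM (FC n n0) mG Gb.
Qed.

Lemma uniB_mul F G : uniB F -> uniB G -> uniB (fun n x => F n x * G n x).
Proof.
move=> [C FC] [C' GC]; exists (C * C') => n n0.
have [mF Fb] := FC n n0; have [mG Gb] := GC n n0.
split=> [|x]; first exact: measurable_funM.
by rewrite normrM ler_pM.
Qed.

Lemma uniB_D F G : uniB F -> uniB G -> uniB (fun n x => F n x + G n x).
Proof.
move=> [C FC] [C' GC]; exists (C + C') => n n0.
have [mF Fb] := FC n n0; have [mG Gb] := GC n n0.
split=> [|x]; first exact: measurable_funD.
by rewrite (le_trans (ler_normD _ _))// lerD.
Qed.

Lemma eq_uniB F G : (forall n, (0 < n)%N -> F n =1 G n) -> uniB F -> uniB G.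
Proof.
move=> FG [C FC]; exists C => n n0.
by rewrite -(funext (FG n n0)); exact: FC.
Qed.

Lemma uniB_prod (I : Type) (s : seq I) (Q : pred I) (F : I -> nat -> R -> R) :
  (forall i, uniB (F i)) -> uniB (fun n x => \prod_(i <- s | Q i) F i n x).
Proof.
move=> FB; elim: s => [|i s IHs].
  exists 1 => n n0; split=> [|x].
    by under eq_fun do rewrite big_nil; exact: measurable_cst.
  by rewrite big_nil normr1.
case Qi: (Q i).
  by apply: eq_uniB (uniB_mul (FB i) IHs) => n _ x; rewrite big_cons Qi.
by apply: eq_uniB IHs => n _ x; rewrite big_cons Qi.
Qed.

(** Telescoping, one factor at a time. *)
Lemma uniO_prodB r (I : Type) (s : seq I) (Q : pred I) (F G : I -> nat -> R -> R) :
  (forall n, (0 < n)%N -> 0 <= r n) ->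
  (forall i, uniB (F i)) -> (forall i, uniB (G i)) ->
  (forall i, uniO r (fun n x => F i n x - G i n x)) ->
  uniO r (fun n x => \prod_(i <- s | Q i) F i n x - \prod_(i <- s | Q i) G i n x).
Proof.
move=> r0 FB GB FG; elim: s => [|i s IHs].
  by apply: eq_uniO (uniO_0 r0) => n _ x; rewrite !big_nil subrr.
case Qi: (Q i); last by apply: eq_uniO IHs => n _ x; rewrite !big_cons Qi.
have tailO := uniO_mulB (FG i) (uniB_prod s Q GB).
apply: eq_uniO (uniO_D (uniO_mulB IHs (FB i)) tailO) => n _ x.
by rewrite !big_cons Qi; ring.
Qed.

(** The Leibniz rule for the derivative of the product at a in direction d,
    splitting off the first index. *)
Lemma sum_prod_cons (I : eqType) (m0 : I) (s : seq I) (a d : I -> R) :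
  uniq (m0 :: s) ->
  \sum_(m <- m0 :: s) d m * \prod_(k <- m0 :: s | k != m) a k =
  d m0 * \prod_(k <- s) a k + a m0 * \sum_(m <- s) d m * \prod_(k <- s | k != m) a k.
Proof.
move=> /= /andP[m0s us]; rewrite big_cons big_cons eqxx/=; congr (_ * _ + _).
  rewrite big_seq_cond [RHS]big_seq_cond; apply: eq_bigl => k.
  by rewrite andbT; case: eqVneq => [->|_]; rewrite ?andbT// andbF (negbTE m0s).
rewrite mulr_sumr big_seq [RHS]big_seq; apply: eq_bigr => m ms.
have -> : \prod_(k <- m0 :: s | k != m) a k = a m0 * \prod_(k <- s | k != m) a k.
  by rewrite big_cons; case: eqVneq ms m0s => // -> ->.
by ring.
Qed.

(** The first order expansion of a product: every term of the remainder
    contains at least two of the increments D. *)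
Lemma uniO_prod_expansion r (I : eqType) (s : seq I) (A D : I -> nat -> R -> R) :
  uniq s -> (forall n, (0 < n)%N -> 0 <= r n <= 1) ->
  (forall i, uniB (A i)) -> (forall i, uniO r (D i)) ->
  uniO (fun n => r n * r n) (fun n x =>
    \prod_(i <- s) (A i n x + D i n x) - \prod_(i <- s) A i n x
    - \sum_(i <- s) D i n x * \prod_(k <- s | k != i) A k n x).
Proof.
move=> us r1 AB DO.
have r0 n : (0 < n)%N -> 0 <= r n by move=> /r1/andP[].
have ADB i : uniB (fun n x => A i n x + D i n x) by apply: uniB_D (uniO_uniB r1 (DO i)).
have diff t : uniO r (fun n x =>
    \prod_(i <- t) (A i n x + D i n x) - \prod_(i <- t) A i n x).
  apply: uniO_prodB => // i.
  by apply: eq_uniO (DO i) => n _ x; rewrite addrC addKr.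
elim: s us => [_|m0 s IHs us].
  apply: eq_uniO (uniO_0 _) => [n _ x|n n0]; last by rewrite mulr_ge0// r0.
  by rewrite !big_nil; ring.
have := uniO_D (uniO_mulB (IHs _) (AB m0)) (uniO_mul (diff s) (DO m0)).
move=> /(_ _)[|C]; first by case/andP: us.
move=> CO; apply: eq_uniO (ex_intro _ C CO) => n _ x.
by rewrite sum_prod_cons// !big_cons; ring.
Qed.

End uniform_classes.

(** * Expansions of a smoothed density *)

Lemma integrableRD d (T : measurableType d) (R : realType)
    (mu : {measure set T -> \bar R}) (f g : T -> R) :
  mu.-integrable setT (EFin \o f) -> mu.-integrable setT (EFin \o g) ->
  mu.-integrable setT (EFin \o (fun t => f t + g t)).
Proof. by move=> If Ig; exact: integrableD If Ig. Qed.

Section smoothing_expansions.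
Context (R : realType) (p : R -> R) (hp : density_assumptions p) (B : R).
Hypothesis pB : forall s, (s <= 3)%N -> LinfL1_le (derive1n s p) B.

Let pB0 : LinfL1_le p B := pB (s := 0%N) isT.
Let mp : measurable_fun setT p.
Proof. by case: pB0. Qed.

Section general_weight.
Context (W : R -> R) (w0 w1 h : R).
Hypotheses (mW : measurable_fun setT W) (W0 : forall t, 0 <= W t).
Hypothesis (intW : (\int[leb]_t (W t)%:E = w0%:E)%E).
Hypothesis (h0 : 0 < h).

Let smooth0 := @LinfL1_le_smoothing R W (fun a x => p (x - a)) 0 B h w0 mW W0
  ltac:(by under eq_integral do rewrite expr0 mul1r; rewrite intW)
  (measurable_shift2 mp)
  ltac:(by move=> a; rewrite expr0 mulr1; exact: LinfL1_le_shift) h0.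

Lemma integrable_smooth x :
  leb.-integrable setT (EFin \o (fun t => W t * p (x - h * t))).
Proof. exact: (proj1 smooth0 x). Qed.

Lemma LinfL1_le_smooth : LinfL1_le (kernel_smooth W p h) (B * w0).
Proof. by case: smooth0 => _; rewrite expr0 mulr1. Qed.

Lemma integrable_weight : leb.-integrable setT (EFin \o W).
Proof.
apply/integrableP; split; first exact: measurable_fun_EFin.
by under eq_integral do rewrite /= ger0_norm//; rewrite intW ltry.
Qed.

(** First order estimate, enough for the weight K^2, whose first moment need
    not vanish. *)
Lemma LinfL1_le_smoothB : (\int[leb]_t (`|t| * W t)%:E <= w1%:E)%E ->
  LinfL1_le (fun x => kernel_smooth W p h x - w0 * p x) (2 * B * h * w1).
Proof.
move=> intW1.
have dp : forall y, derivable p y 1 by move=> y; exact: (density_derivable hp (s := 0%N)).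
have cdp : continuous (derive1 p).
  move=> y; apply/differentiable_continuous/derivable1_diffP.
  exact: (density_derivable hp (s := 1%N)).
have [_] := @LinfL1_le_smoothing R W (fun a x => p (x - a) - p x) 1 (2 * B) h w1
  mW W0 intW1
  (measurable_funB (measurable_shift2 mp) (measurableT_comp mp (@measurable_snd _ _ R R)))
  (fun a => LinfL1_le_increment a mp dp cdp (pB (s := 1%N) isT)) h0.
rewrite expr1; congr LinfL1_le; apply/funext => x.
have ip : leb.-integrable setT (EFin \o (fun t => p x * W t)).
  exact: integrableZl integrable_weight.
transitivity (\int[leb]_t (W t * p (x - h * t) - p x * W t)).
  by apply: eq_Rintegral => t _; ring.
rewrite RintegralB//; last exact: integrable_smooth.
rewrite RintegralZl//; last exact: integrable_weight.
by rewrite mulrC {2}/Rintegral intW.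
Qed.

End general_weight.

(** Integrating the Taylor remainder against the kernel, the term of order 0
    contributes p because K has mass 1, and the term of order 1 vanishes because
    K has mean 0. *)
Lemma LinfL1_le_smooth_taylor (K : R -> R) (h : R) :
  kernel_assumptions K -> 0 < h ->
  LinfL1_le (fun x => kernel_smooth K p h x - p x -
    h ^+ 2 * (fine (kernel_moment K 2) / 2) * derive1n 2 p x)
    (2 * B * h ^+ 3 * fine (kernel_moment K 3)).
Proof.
move=> hK h0.
have momE s : (s <= 3)%N -> (kernel_moment K s = (fine (kernel_moment K s))%:E)%E.
  move=> s3; rewrite fineK// ge0_fin_numE; first exact: kernel_moments.
  apply: integral_ge0 => t _; rewrite lee_fin mulr_ge0 ?exprn_ge0//.
  exact: kernel_ge0.
have mK := kernel_measurable hK; have K0 := kernel_ge0 hK.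
have tK s : (s <= 3)%N -> leb.-integrable setT (EFin \o (fun t => t ^+ s * K t)).
  move=> s3; apply/integrableP; split.
    by apply: measurable_fun_EFin; apply: measurable_funM => //; exact: measurable_funX.
  under eq_integral do rewrite /= normrM normrX (ger0_norm (K0 _)).
  exact: kernel_moments.
have [_] := @LinfL1_le_smoothing R K (taylor_rem2 p) 3 (2 * B) h
  (fine (kernel_moment K 3)) mK K0 ltac:(by rewrite -momE)
  (measurable_taylor_rem2 (fun s s2 => let: And3 m _ _ := pB (leqW s2) in m))
  (fun a => LinfL1_le_taylor_rem2 a hp pB) h0.
congr LinfL1_le; apply/funext => x.
have iK : leb.-integrable setT (EFin \o K).
  exact: integrable_weight mK K0 (kernel_int1 hK).
have iKp := integrable_smooth mK K0 (kernel_int1 hK) h0 x.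
have iz s a : (s <= 3)%N -> leb.-integrable setT (EFin \o (fun t => a * (t ^+ s * K t))).
  by move=> s3; exact: integrableZl (tK _ s3).
transitivity (\int[leb]_t (K t * p (x - h * t) + (- p x * (t ^+ 0 * K t)
    + (h * derive1n 1 p x * (t ^+ 1 * K t)
       + - (h ^+ 2 / 2 * derive1n 2 p x) * (t ^+ 2 * K t))))).
  by apply: eq_Rintegral => t _; rewrite /taylor_rem2 expr0 expr1; field.
have i12 : leb.-integrable setT (EFin \o (fun t => h * derive1n 1 p x * (t ^+ 1 * K t)
       + - (h ^+ 2 / 2 * derive1n 2 p x) * (t ^+ 2 * K t))).
  by apply: integrableRD; exact: iz.
have i012 : leb.-integrable setT (EFin \o (fun t => - p x * (t ^+ 0 * K t)
    + (h * derive1n 1 p x * (t ^+ 1 * K t)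
       + - (h ^+ 2 / 2 * derive1n 2 p x) * (t ^+ 2 * K t)))).
  by apply: integrableRD => //; exact: iz.
rewrite RintegralD// RintegralD//; last exact: iz.
rewrite RintegralD//; [|exact: iz..].
rewrite !RintegralZl//; [|exact: tK..].
have -> : \int[leb]_t K t = 1 by rewrite /Rintegral kernel_int1.
have -> : \int[leb]_t (t ^+ 1 * K t) = 0.
  by rewrite /Rintegral; under eq_integral do rewrite expr1; rewrite kernel_mean0.
have -> : \int[leb]_t (t ^+ 2 * K t) = fine (kernel_moment K 2).
  by rewrite /Rintegral; under eq_integral do rewrite -real_normK ?num_real//.
by rewrite /kernel_smooth; field.
Qed.

End smoothing_expansions.

(** * Rates of the bias and variance errors *)

Lemma LinfL1_le_integralB (R : realType) (F G : R -> R) (a b c : R) :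
  LinfL1_le F a -> LinfL1_le G b -> LinfL1_le (fun x => F x - G x) c ->
  [/\ (\int[leb]_x (F x)%:E)%E \is a fin_num,
      (\int[leb]_x (G x)%:E)%E \is a fin_num &
      `|fine (\int[leb]_x (F x)%:E - \int[leb]_x (G x)%:E)%E| <= c].
Proof.
move=> Fa Gb FGc.
have iF := LinfL1_le_integrable Fa; have iG := LinfL1_le_integrable Gb.
have [mFG _ FG1] := FGc.
split; [exact: integrable_fin_num|exact: integrable_fin_num|].
have iFG : leb.-integrable setT (fun x => (F x - G x)%:E).
  exact: LinfL1_le_integrable FGc.
have -> : (\int[leb]_x (F x)%:E - \int[leb]_x (G x)%:E =
    \int[leb]_x (F x - G x)%:E)%E by rewrite -integralB.
rewrite -lee_fin -[leLHS]/(`|(fine _)%:E|%E) fineK; last exact: integrable_fin_num.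
apply: le_trans FG1; apply: le_abse_integral => //.
exact: (measurable_fun_EFin mFG).
Qed.

Section error_rates.
Context (R : realType) (M : nat) (K : R -> R) (hK : kernel_assumptions K).
Context (p : 'I_M -> R -> R) (hp : forall m, density_assumptions (p m)).
Context (N : nat -> 'I_M -> nat) (h : nat -> 'I_M -> R).
Context (eta eps : nat -> R) (A E : R).
Hypothesis h0 : forall n m, (0 < n)%N -> 0 < h n m.
Hypothesis eta01 : forall n, (0 < n)%N -> 0 <= eta n <= 1.
Hypothesis eps01 : forall n, (0 < n)%N -> 0 <= eps n <= 1.
Hypothesis hA : forall n m, (0 < n)%N -> h n m <= A * eta n.
Hypothesis NhE : forall n m, (0 < n)%N ->
  0 <= ((N n m)%:R * h n m)^-1 <= E * eps n.

Let b m n x := kernel_smooth K (p m) (h n m) x.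
Let s m n x := kernel_smooth (fun t => K t ^+ 2) (p m) (h n m) x.
Let v m n x := kde_variance K p (N n) (h n) m x.
Let k2 := fine (kernel_moment K 2).
Let kappa := fine (\int[leb]_t (K t ^+ 2)%:E)%E.

Let eta0 n : (0 < n)%N -> 0 <= eta n. Proof. by move=> /eta01/andP[]. Qed.
Let eps0 n : (0 < n)%N -> 0 <= eps n. Proof. by move=> /eps01/andP[]. Qed.
Let one01 n : (0 < n)%N -> 0 <= (1 : R) <= 1. Proof. by rewrite ler01 lexx. Qed.

Let kappaE : (\int[leb]_t (K t ^+ 2)%:E)%E = kappa%:E.
Proof.
rewrite fineK// ge0_fin_numE; first exact: kernel_sqr.
by apply: integral_ge0 => t _; rewrite lee_fin sqr_ge0.
Qed.

Let mK := kernel_measurable hK.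
Let mK2 : measurable_fun setT (fun t => K t ^+ 2).
Proof. exact: measurable_funX. Qed.
Let K20 t : 0 <= K t ^+ 2. Proof. exact: sqr_ge0. Qed.

Let pO m j : (j <= 3)%N -> uniO (fun=> 1) (fun _ => derive1n j (p m)).
Proof.
move=> j3; have [B pB] := density_LinfL1 (hp m).
by exists B => n _; rewrite mulr1; exact: pB.
Qed.

Let bO m : uniO (fun=> 1) (b m).
Proof.
have [B pB] := density_LinfL1 (hp m).
exists (B * 1) => n n0; rewrite mulr1.
exact: (LinfL1_le_smooth pB mK (kernel_ge0 hK) (kernel_int1 hK) (h0 m n0)).
Qed.

Let taylorO m : uniO (fun n => eta n ^+ 3)
  (fun n x => b m n x - p m x - h n m ^+ 2 * (k2 / 2) * derive1n 2 (p m) x).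
Proof.
have [B pB] := density_LinfL1 (hp m).
have B0 := LinfL1_le_ge0 (pB 0%N isT).
exists (2 * B * A ^+ 3 * fine (kernel_moment K 3)) => n n0.
apply: LinfL1_leW (LinfL1_le_smooth_taylor (hp m) pB hK (h0 m n0)).
have k30 : 0 <= fine (kernel_moment K 3).
  apply: fine_ge0; apply: integral_ge0 => t _.
  by rewrite lee_fin mulr_ge0 ?exprn_ge0//; exact: kernel_ge0.
have hA3 : h n m ^+ 3 <= A ^+ 3 * eta n ^+ 3.
  rewrite -exprMn lerXn2r ?nnegrE ?hA// ltW ?h0//.
  by rewrite (lt_le_trans (h0 m n0))// hA.
rewrite [leRHS](_ : _ = 2 * B * (A ^+ 3 * eta n ^+ 3) * fine (kernel_moment K 3)).
  by rewrite ler_wpM2r// ler_wpM2l// mulr_ge0.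
by ring.
Qed.

Let h_eta m n : (0 < n)%N -> `|h n m| <= A * eta n.
Proof. by move=> n0; rewrite gtr0_norm ?hA ?h0. Qed.

Let h2_eta m n : (0 < n)%N -> `|h n m ^+ 2 * (k2 / 2)| <= A ^+ 2 * `|k2 / 2| * eta n ^+ 2.
Proof.
move=> n0; rewrite normrM mulrAC ler_wpM2r// normrX -exprMn.
by rewrite lerXn2r ?nnegrE ?h_eta// (le_trans _ (h_eta m n0)).
Qed.

Let mainO m : uniO (fun n => eta n ^+ 2)
  (fun n x => h n m ^+ 2 * (k2 / 2) * derive1n 2 (p m) x).
Proof.
have := uniO_scale (h2_eta m) (pO m (j := 2%N) isT).
by apply: (@uniO_weaken _ _ _ 1) => n n0; rewrite mulr1 mul1r lexx andbT exprn_ge0// eta0.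
Qed.

Let eta_exp i j n : (i <= j)%N -> (0 < n)%N -> 0 <= eta n ^+ j <= 1 * eta n ^+ i.
Proof.
move=> ij n0; have /andP[e0 e1] := eta01 n0.
by rewrite exprn_ge0// mul1r ler_wiXn2l.
Qed.

Let diffO2 m : uniO (fun n => eta n ^+ 2) (fun n x => b m n x - p m x).
Proof.
have /uniO_D := uniO_weaken (fun n => @eta_exp 2 3 n isT) (taylorO m).
by move=> /(_ _ (mainO m)); apply: eq_uniO => n _ x; rewrite subrK.
Qed.

Let diffO m : uniO eta (fun n x => b m n x - p m x).
Proof.
apply: uniO_weaken (diffO2 m) => n n0.
by have := @eta_exp 1 2 n isT n0; rewrite expr1; exact: id.
Qed.

Let pB m : uniB (fun _ => p m).
Proof. exact: uniO_uniB one01 (pO m (j := 0%N) isT). Qed.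

Let bB m : uniB (b m).
Proof. exact: uniO_uniB one01 (bO m). Qed.

(** The first order variation of the product of the p_m when each p_m is moved
    by h_m^2 (k_2 / 2) p_m''; its squared L2 norm is the bias part of the AMISE. *)
Definition bias_leading n x :=
  \sum_(m < M) h n m ^+ 2 * (k2 / 2) * derive1n 2 (p m) x *
    \prod_(k < M | k != m) p k x.

Lemma bias_leading_uniO : uniO (fun n => eta n ^+ 2) bias_leading.
Proof.
apply: uniO_sum => [n n0|m]; first by rewrite exprn_ge0// eta0.
by apply: eq_uniO (uniO_mulB (mainO m) (uniB_prod _ _ pB)) => n _ x; rewrite mulrC.
Qed.

(** With d_m = b_m - p_m = O(eta^2), the product expansion has remainder
    O(eta^4), and replacing d_m by its leading part costs O(eta^3). *)
Lemma bias_remainder_uniO : uniO (fun n => eta n ^+ 3)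
  (fun n x => phatstar_mean K p (h n) x - pstar p x - bias_leading n x).
Proof.
have e2 n : (0 < n)%N -> 0 <= eta n ^+ 2 <= 1.
  by move=> n0; have := @eta_exp 0 2 n isT n0; rewrite expr0 mulr1.
have e4 n : (0 < n)%N -> 0 <= eta n ^+ 2 * eta n ^+ 2 <= 1 * eta n ^+ 3.
  by move=> n0; rewrite -exprD eta_exp.
have linO m : uniO (fun n => eta n ^+ 3) (fun n x => \prod_(k < M | k != m) p k x *
    (b m n x - p m x - h n m ^+ 2 * (k2 / 2) * derive1n 2 (p m) x)).
  exact: uniO_mulB (taylorO m) (uniB_prod _ _ pB).
have sumO := uniO_sum (index_enum 'I_M) xpredT
  (fun n n0 => exprn_ge0 3 (@eta0 n n0)) linO.
have quadO := uniO_weaken e4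
  (uniO_prod_expansion (index_enum_uniq 'I_M) e2 pB diffO2).
apply: eq_uniO (uniO_D quadO sumO) => n _ x.
rewrite /bias_leading /pstar /phatstar_mean -addrA -[in LHS]sumrN -big_split/=.
have -> : \prod_m (p m x + (b m n x - p m x)) = \prod_m b m n x.
  by apply: eq_bigr => m _; rewrite addrC subrK.
congr (_ + _); rewrite -sumrN; apply: eq_bigr => m _; ring.
Qed.

Let rhoO := bias_remainder_uniO.

Lemma bias_uniO : uniO (fun n => eta n ^+ 2)
  (fun n x => phatstar_mean K p (h n) x - pstar p x).
Proof.
have := uniO_D (uniO_weaken (fun n => @eta_exp 2 3 n isT) rhoO) bias_leading_uniO.
by apply: eq_uniO => n _ x; rewrite subrK.
Qed.

(** With bias f and leading term l, f^2 - l^2 = (f + l) (f - l), where the first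
    factor is O(eta^2) and the second O(eta^3). *)
Lemma bias_sqr_uniO : uniO (fun n => eta n ^+ 5)
  (fun n x => (phatstar_mean K p (h n) x - pstar p x) ^+ 2 - bias_leading n x ^+ 2).
Proof.
have := uniO_mul (uniO_D bias_uniO bias_leading_uniO) rhoO.
move=> H; apply: eq_uniO (uniO_weaken (A := 1) _ H) => [n _ x|n n0]; first by ring.
by rewrite mul1r -exprD lexx andbT exprn_ge0// eta0.
Qed.

Let k2E : (kernel_moment K 2 = k2%:E)%E.
Proof.
rewrite fineK// ge0_fin_numE; first exact: kernel_moments.
apply: integral_ge0 => t _; rewrite lee_fin mulr_ge0 ?exprn_ge0//.
exact: kernel_ge0.
Qed.

Let mp m j : (j <= 3)%N -> measurable_fun setT (derive1n j (p m)).
Proof. by move=> j3; have [C /(_ 1%N isT)[]] := pO m j3. Qed.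

Lemma AMISE_biasE n :
  (AMISE_bias K p (h n) = \int[leb]_x (bias_leading n x ^+ 2)%:E)%E.
Proof.
rewrite /AMISE_bias k2E -EFin_expe -EFinM -ge0_integralZl_EFin//.
- apply: eq_integral => x _; rewrite -EFinM; congr EFin.
  rewrite /bias_leading.
  rewrite [in RHS](_ : \sum_(m < M) _ = k2 / 2 * \sum_(m < M) h n m ^+ 2 *
    derive1n 2 (p m) x * \prod_(k < M | k != m) p k x); first by field.
  by rewrite mulr_sumr; apply: eq_bigr => m _; ring.
- by move=> x _; rewrite lee_fin sqr_ge0.
- apply: measurable_fun_EFin; apply: measurable_funX.
  apply: measurable_sum_pred => m; apply: measurable_funM.
    by apply: measurable_funM => //; exact: (@mp m 2 isT).
  by apply: measurable_prod_pred => k; exact: (@mp k 0 isT).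
- by rewrite mulr_ge0 ?sqr_ge0.
Qed.

Lemma error_bias_rate : exists C, forall n, (0 < n)%N ->
  [/\ (\int[leb]_x ((phatstar_mean K p (h n) x - pstar p x) ^+ 2)%:E)%E \is a fin_num,
      AMISE_bias K p (h n) \is a fin_num &
      `|fine (\int[leb]_x ((phatstar_mean K p (h n) x - pstar p x) ^+ 2)%:E
              - AMISE_bias K p (h n))%E| <= C * eta n ^+ 5].
Proof.
have [C HC] := bias_sqr_uniO; exists C => n n0.
have [C1 H1] := uniO_mul bias_uniO bias_uniO.
have [C2 H2] := uniO_mul bias_leading_uniO bias_leading_uniO.
rewrite AMISE_biasE.
exact: LinfL1_le_integralB (H1 n n0) (H2 n n0) (HC n n0).
Qed.

Let Nh0 n m : (0 < n)%N -> `|((N n m)%:R * h n m)^-1| <= E * eps n.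
Proof. by move=> n0; have /andP[? ?] := NhE m n0; rewrite ger0_norm. Qed.

Let Ninv n m : (0 < n)%N -> `|(N n m)%:R^-1 : R| <= A * E * (eps n * eta n).
Proof.
move=> n0; have hn0 := h0 m n0.
have -> : (N n m)%:R^-1 = h n m * ((N n m)%:R * h n m)^-1.
  by rewrite invfM mulrCA divff ?mulr1// gt_eqF.
rewrite normrM (_ : A * E * (eps n * eta n) = (A * eta n) * (E * eps n)); last by ring.
by rewrite ler_pM// ?h_eta// Nh0.
Qed.

Let sdiffO m : uniO eta (fun n x => s m n x - kappa * p m x).
Proof.
have [B Bp] := density_LinfL1 (hp m).
have B0 := LinfL1_le_ge0 (Bp 0%N isT).
have [C KC] := kernel_bounded hK.
have C0 : 0 <= C := le_trans (kernel_ge0 hK 0) (KC 0).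
pose k1 := fine (kernel_moment K 1).
have k1E : (kernel_moment K 1 = k1%:E)%E.
  rewrite fineK// ge0_fin_numE; first exact: kernel_moments.
  apply: integral_ge0 => t _; rewrite lee_fin mulr_ge0 ?exprn_ge0//.
  exact: kernel_ge0.
have mt j : measurable_fun setT (fun t : R => `|t| * K t ^+ j).
  by apply: measurable_funM; [exact: (measurable_norm_exp 1)|exact: measurable_funX].
have K2k1 : (\int[leb]_t (`|t| * K t ^+ 2)%:E <= (C * k1)%:E)%E.
  rewrite EFinM -k1E /kernel_moment -ge0_integralZl_EFin//; first last.
  - by apply: measurable_fun_EFin; exact: (mt 1).
  - by move=> t _; rewrite lee_fin mulr_ge0 ?exprn_ge0//; exact: kernel_ge0.
  apply: ge0_le_integral => //.
  - by move=> t _; rewrite lee_fin mulr_ge0.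
  - by apply: measurable_fun_EFin; exact: (mt 2).
  - by apply: measurable_fun_EFin; apply: measurable_funM => //; exact: (mt 1).
  - move=> t _; rewrite -EFinM lee_fin expr1 [leRHS]mulrCA ler_wpM2l// expr2.
    by rewrite ler_wpM2r// (kernel_ge0 hK).
exists (2 * B * A * (C * k1)) => n n0.
apply: LinfL1_leW (LinfL1_le_smoothB (hp m) Bp mK2 K20 kappaE (h0 m n0) K2k1).
rewrite [leRHS](_ : _ = 2 * B * (A * eta n) * (C * k1)); last by ring.
apply: ler_wpM2r; last by apply: ler_wpM2l; [rewrite mulr_ge0|exact: hA].
rewrite mulr_ge0//; apply: fine_ge0; apply: integral_ge0 => t _.
by rewrite lee_fin mulr_ge0 ?exprn_ge0//; exact: kernel_ge0.
Qed.

Let vlead m n x := ((N n m)%:R * h n m)^-1 * (kappa * p m x).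

Let vleadO m : uniO eps (vlead m).
Proof.
have := uniO_scale (fun n n0 => @Nh0 n m n0) (uniO_cst kappa (pO m (j := 0%N) isT)).
by apply: (@uniO_weaken _ _ _ 1) => n n0; rewrite mulr1 mul1r lexx eps0.
Qed.

Let vdiffO m : uniO (fun n => eps n * eta n) (fun n x => v m n x - vlead m n x).
Proof.
have b2 := uniO_scale (fun n n0 => @Ninv n m n0) (uniO_mul (bO m) (bO m)).
have e1 n : (0 < n)%N -> 0 <= eps n * eta n * (1 * 1) <= 1 * (eps n * eta n).
  by move=> n0; rewrite !mulr1 mul1r lexx mulr_ge0 ?eps0 ?eta0.
have := uniO_B (uniO_scale (fun n n0 => @Nh0 n m n0) (sdiffO m)) (uniO_weaken e1 b2).
by apply: eq_uniO => n _ x; rewrite /v /kde_variance /vlead /b /s; ring.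
Qed.

Let vO m : uniO eps (v m).
Proof.
have e1 n : (0 < n)%N -> 0 <= eps n * eta n <= 1 * eps n.
  move=> n0; have /andP[? ?] := eta01 n0.
  by rewrite mulr_ge0 ?eps0// mul1r ler_piMr ?eps0.
have := uniO_D (uniO_weaken e1 (vdiffO m)) (vleadO m).
by apply: eq_uniO => n _ x; rewrite subrK.
Qed.

(** Each factor 1 / (N_m h_m) is O(eps), so this is O(eps), while v_m differs
    from its leading part by O(eps eta): the kernel average of K^2 differs from
    its limit by O(eta), and 1 / N_m is h_m times 1 / (N_m h_m). *)
Definition variance_leading n x :=
  kappa * \sum_(m < M) p m x / ((N n m)%:R * h n m) *
    \prod_(k < M | k != m) p k x ^+ 2.

Let p2B m : uniB (fun _ x => p m x ^+ 2).
Proof. by apply: eq_uniB (uniB_mul (pB m) (pB m)) => n _ x; rewrite expr2. Qed.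

Let b2B m : uniB (fun n x => b m n x ^+ 2).
Proof. by apply: eq_uniB (uniB_mul (bB m) (bB m)) => n _ x; rewrite expr2. Qed.

Lemma variance_leadingE n x : variance_leading n x =
  \sum_(m < M) vlead m n x * \prod_(k < M | k != m) p k x ^+ 2.
Proof.
by rewrite /variance_leading mulr_sumr; apply: eq_bigr => m _; rewrite /vlead; ring.
Qed.

Lemma variance_leading_uniO : uniO eps variance_leading.
Proof.
have lO m : uniO eps (fun n x => \prod_(k < M | k != m) p k x ^+ 2 * vlead m n x).
  exact: uniO_mulB (vleadO m) (uniB_prod _ _ p2B).
apply: eq_uniO (uniO_sum (index_enum 'I_M) xpredT eps0 lO) => n _ x.
by rewrite variance_leadingE; apply: eq_bigr => m _; rewrite mulrC.
Qed.

(** Three errors add up: the quadratic remainder of the product expansion,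
    O(eps^2); the error on each v_m, O(eps eta); and the replacement of b_k^2 by
    p_k^2 in a term already O(eps), again O(eps eta). *)
Lemma variance_remainder_uniO : uniO (fun n => eps n * (eps n + eta n)) (fun n x =>
  phatstar_variance K p (N n) (h n) x - variance_leading n x).
Proof.
have r0 n : (0 < n)%N -> 0 <= eps n * (eps n + eta n).
  by move=> n0; rewrite mulr_ge0 ?addr_ge0 ?eps0 ?eta0.
have e1 n : (0 < n)%N -> 0 <= eps n * eps n <= 1 * (eps n * (eps n + eta n)).
  move=> n0; rewrite mulr_ge0 ?eps0// mul1r ler_wpM2l ?eps0//.
  by rewrite lerDl eta0.
have e2 n : (0 < n)%N -> 0 <= eps n * eta n <= 1 * (eps n * (eps n + eta n)).
  move=> n0; rewrite mulr_ge0 ?eps0 ?eta0// mul1r ler_wpM2l ?eps0//.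
  by rewrite lerDr eps0.
have quadO := uniO_weaken e1 (uniO_prod_expansion (index_enum_uniq 'I_M) eps01 b2B vO).
have sqdiffO m : uniO eta (fun n x => b m n x ^+ 2 - p m x ^+ 2).
  apply: eq_uniO (uniO_mulB (diffO m) (uniB_D (bB m) (pB m))) => n _ x; ring.
have linO m : uniO (fun n => eps n * (eps n + eta n)) (fun n x =>
    \prod_(k < M | k != m) b k n x ^+ 2 * (v m n x - vlead m n x)
    + vlead m n x * (\prod_(k < M | k != m) b k n x ^+ 2
                     - \prod_(k < M | k != m) p k x ^+ 2)).
  apply: uniO_D; apply: (uniO_weaken e2).
    exact: uniO_mulB (vdiffO m) (uniB_prod _ _ b2B).
  exact: uniO_mul (uniO_prodB _ _ eta0 b2B p2B sqdiffO) (vleadO m).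
apply: eq_uniO (uniO_D quadO (uniO_sum (index_enum 'I_M) xpredT r0 linO)) => n _ x.
rewrite variance_leadingE /phatstar_variance -addrA -[in LHS]sumrN -big_split/=.
congr (_ + _); rewrite -sumrN; apply: eq_bigr => m _; ring.
Qed.

Lemma AMISE_varianceE n :
  (0 < n)%N ->
  (AMISE_variance K p (N n) (h n) = \int[leb]_x (variance_leading n x)%:E)%E.
Proof.
move=> n0; rewrite /AMISE_variance kappaE muleC -ge0_integralZl_EFin//.
- move=> x _; rewrite lee_fin sumr_ge0// => m _; rewrite mulr_ge0 ?prodr_ge0//.
  + have /andP[? _] := NhE m n0; rewrite mulr_ge0//.
    exact: prob_density_ge0 (density_prob (hp m)) _.
  + by move=> k _; rewrite sqr_ge0.
- apply: measurable_fun_EFin; apply: measurable_sum_pred => m.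
  apply: measurable_funM; first by apply: measurable_funM => //; exact: (@mp m 0 isT).
  apply: measurable_prod_pred => k.
  by apply: measurable_funX; exact: (@mp k 0 isT).
- by apply: fine_ge0; apply: integral_ge0 => t _; rewrite lee_fin.
Qed.

Lemma error_variance_rate : exists C, forall n, (0 < n)%N ->
  [/\ measurable_fun setT (phatstar_variance K p (N n) (h n)),
      (\int[leb]_x (phatstar_variance K p (N n) (h n) x)%:E)%E \is a fin_num,
      AMISE_variance K p (N n) (h n) \is a fin_num &
      `|fine (\int[leb]_x (phatstar_variance K p (N n) (h n) x)%:E
              - AMISE_variance K p (N n) (h n))%E| <= C * (eps n * (eps n + eta n))].
Proof.
have [C HC] := variance_remainder_uniO; exists C => n n0.
have [C2 H2] := variance_leading_uniO.
have H1 := LinfL1_leD (HC n n0) (H2 n n0).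
have E1 : (fun x => phatstar_variance K p (N n) (h n) x - variance_leading n x
    + variance_leading n x) = phatstar_variance K p (N n) (h n).
  by apply/funext => x; rewrite subrK.
rewrite {}E1 in H1; rewrite AMISE_varianceE//.
have [? ? ?] := LinfL1_le_integralB H1 (H2 n n0) (HC n n0).
by split => //; case: H1.
Qed.

End error_rates.

(** * Norms on row vectors and the scaling regime *)

Section norm_equivalence.
Context (R : realType) (M : nat) (nrm : 'rV[R]_M -> R) (hnrm : is_norm nrm).

Let nrm0 : nrm 0 = 0.
Proof. by rewrite -(scale0r (0 : 'rV[R]_M)) is_normZ// normr0 mul0r. Qed.

Let coord_le_norm (u : 'rV[R]_M) i : `|u ord0 i| <= `|u|.
Proof.
rewrite [leRHS]/Num.norm/= mx_normrE.
by apply/bigmax_geP; right => /=; exists (ord0, i).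
Qed.

Lemma is_norm_le_sup : exists2 C, 0 < C &
  forall (u : 'rV[R]_M) b, 0 <= b -> (forall i, `|u ord0 i| <= b) -> nrm u <= C * b.
Proof.
exists (1 + \sum_i nrm (delta_mx 0 i)) => [|u b b0 ub].
  by rewrite ltr_pwDl// sumr_ge0// => i _; exact: is_norm_ge0.
rewrite {1}[u]row_sum_delta.
apply: (@le_trans _ _ (\sum_i nrm (u ord0 i *: delta_mx 0 i))).
  elim/big_ind2 : _ => [|x a y c xa yc|//]; first by rewrite nrm0.
  by rewrite (le_trans (is_normD hnrm _ _))// lerD.
rewrite mulrDl mul1r ler_wpDl// mulr_suml; apply: ler_sum => i _.
by rewrite is_normZ// mulrC ler_wpM2l// is_norm_ge0.
Qed.

Lemma is_norm_continuous : continuous nrm.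
Proof.
have [C C0 nC] := is_norm_le_sup.
move=> u; apply/(@cvgrPdist_le _ _ _ _ (nbhs_filter u)) => e e0; near=> v.
have -> : e = C * (e / C) by rewrite mulrC divfK// gt_eqF.
have nD x y : nrm x - nrm y <= nrm (x - y).
  by rewrite lerBlDr -{1}(subrK y x) is_normD.
have nN x : nrm (- x) = nrm x by rewrite -scaleN1r is_normZ// normrN1 mul1r.
apply: (@le_trans _ _ (nrm (u - v))).
  by rewrite ler_norml nD andbT -(nN (u - v)) opprB lerNl opprB nD.
apply: nC => [|i]; first by rewrite divr_ge0 ?ltW.
have : `|u - v| <= e / C.
  by near: v; have /cvgrPdist_le := @cvg_id _ (nbhs u); apply; exact: divr_gt0.
by apply: le_trans; exact: coord_le_norm.
Unshelve. all: by end_near. Qed.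

(** By compactness the norm attains a positive minimum on the unit sphere of
    the sup norm; homogeneity extends the bound. *)
Lemma is_norm_ge_sup : (0 < M)%N -> exists2 c, 0 < c &
  forall (u : 'rV[R]_M) i, c * `|u ord0 i| <= nrm u.
Proof.
move=> M0.
pose S := [set u : 'rV[R]_M | `|u| = 1].
have cS : closed S.
  rewrite (_ : S = (Num.norm : 'rV[R]_M -> R) @^-1` [set 1])//.
  by apply: closed_comp => [u _|]; [exact: norm_continuous|exact: closed_eq].
have compS : compact S.
  apply: bounded_closed_compact => //; exists 1; split => // x x1 u /= ->.
  exact: ltW.
have S0 : S !=set0.
  exists (`|const_mx 1 : 'rV[R]_M|^-1 *: const_mx 1); rewrite /S/=.
  rewrite normrZ normfV normr_id mulVf// normr_eq0; apply/eqP => /matrixP.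
  by move=> /(_ ord0 (Ordinal M0))/eqP; rewrite !mxE oner_eq0.
have [c cS1 cmin] := @EVT_min_rV _ _ nrm S S0 compS
  (continuous_subspaceT is_norm_continuous).
exists (nrm c).
  rewrite lt_neqAle is_norm_ge0// andbT eq_sym; apply/eqP => /(is_norm_eq0 hnrm) c0.
  by move: cS1; rewrite inE /S/= c0 normr0 => /eqP; rewrite eq_sym oner_eq0.
move=> u i; have [->|u0] := eqVneq u 0.
  by rewrite mxE normr0 mulr0 is_norm_ge0.
have u0' : 0 < `|u| by rewrite normr_gt0.
apply: (@le_trans _ _ (nrm c * `|u|)).
  by rewrite ler_wpM2l ?is_norm_ge0// coord_le_norm.
rewrite -ler_pdivlMr//.
have -> : nrm u / `|u| = nrm (`|u|^-1 *: u).
  by rewrite is_normZ// normfV normr_id mulrC.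
by apply: cmin; rewrite inE /S/= normrZ normfV normr_id mulVf// gt_eqF.
Qed.

End norm_equivalence.

Lemma cvg_invn_powR (R : realType) (a : R) : 0 < a ->
  (n%:R^-1 `^ a : R) @[n --> \oo] --> (0 : R).
Proof.
move=> a0; rewrite -cvg_shiftS/=.
have /cvg_at_rightP/(_ (@harmonic R)) := powR_cvg0 a0; apply; split => [n|].
  by rewrite /harmonic/= invr_gt0.
exact: cvg_harmonic.
Qed.

(** Up to constants all the h_i are of order eta = n^-alpha_0 and all the N_i of
    order n. The rate eps = n^(alpha_0 - 1) = 1 / (n eta) is the order of
    1 / (N_i h_i); it tends to 0 because alpha_0 < 1. *)
Lemma scaling_rates (R : realType) (M : nat) (N : nat -> 'I_M -> nat)
    (h : nat -> 'I_M -> R) : scaling_assumptions N h ->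
  exists (eta eps : nat -> R) (a A c C : R),
    [/\ [/\ 0 < a, 0 < A, 0 < c & 0 < C],
        forall n, (0 < n)%N ->
          [/\ 0 < eta n <= 1, 0 < eps n <= 1 & eps n * eta n = n%:R^-1],
        forall n i, (0 < n)%N -> a * eta n <= h n i <= A * eta n,
        forall n i, (0 < n)%N -> c * n%:R <= (N n i)%:R <= C * n%:R &
        eta n @[n --> \oo] --> 0 /\ eps n @[n --> \oo] --> 0].
Proof.
move=> hNh; have [D1 [D2 [D10 D12 ND]]] := scaling_N hNh.
have [A1 [A2 [al [A10 A20 /andP[al0 al1] hA]]]] := scaling_h hNh.
have D20 : 0 < D2 := lt_trans D10 D12.
have n0' n : (0 < n)%N -> 0 < n%:R :> R by rewrite ltr0n.
have ni n : (0 < n)%N -> 0 < (n%:R : R)^-1 <= 1.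
  by move=> n0; rewrite invr_gt0 n0'// invf_le1 ?n0'// ler1n.
have ND' n i : (0 < n)%N -> D1 * n%:R <= (N n i)%:R <= D2 * n%:R.
  by move=> n0; have := ND n i n0; rewrite ler_pdivlMr ?ler_pdivrMr ?n0'.
exists (fun n => n%:R^-1 `^ al), (fun n => n%:R^-1 `^ (1 - al)).
exists (A1 * D2^-1 `^ al), (A2 * D1^-1 `^ al), D1, D2; split => //.
- by split=> //; rewrite mulr_gt0// powR_gt0// invr_gt0.
- move=> n n0; have /andP[i0 i1] := ni n n0.
  have pw b : 0 < b -> 0 < n%:R^-1 `^ b <= (1 : R).
    move=> b0; rewrite powR_gt0//= -[leRHS](powRr0 (n%:R^-1)).
    by rewrite ger_powR ?i0// ltW.
  split; [exact: pw|by apply: pw; rewrite subr_gt0|].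
  by rewrite -powRD ?subrK ?powRr1 ?(ltW i0)// (gt_eqF i0) implybT.
- move=> n i n0; have /andP[NL NU] := ND' n i n0.
  have /andP[hL hU] := hA n i n0.
  have N0 : 0 < (N n i)%:R :> R by apply: lt_le_trans NL; rewrite mulr_gt0// n0'.
  have NE : (N n i)%:R `^ (- al) = (N n i)%:R^-1 `^ al :> R.
    by rewrite -[X in _ = X `^ _]powR_inv1 ?ltW// -powRrM mulN1r.
  have [nn Dn1 Dn2] : [/\ 0 <= (n%:R^-1 : R), 0 <= D1^-1 & 0 <= D2^-1].
    by split; rewrite invr_ge0 ltW// n0'.
  apply/andP; split.
  + apply: le_trans hL; rewrite NE -mulrA -powRM// ler_wpM2l ?(ltW A10) ?(ltW A20)//.
    apply: ge0_ler_powR;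
      rewrite ?nnegrE ?(ltW al0) ?mulr_ge0 ?invr_ge0 ?(ltW N0) ?(ltW D10) ?(ltW D20)//.
    by rewrite -invfM lef_pV2 ?posrE// mulr_gt0 ?n0'.
  + apply: (le_trans hU); rewrite NE -mulrA -powRM// ler_wpM2l ?(ltW A10) ?(ltW A20)//.
    apply: ge0_ler_powR;
      rewrite ?nnegrE ?(ltW al0) ?mulr_ge0 ?invr_ge0 ?(ltW N0) ?(ltW D10) ?(ltW D20)//.
    by rewrite -invfM lef_pV2 ?posrE// mulr_gt0 ?n0'.
- by split; apply: cvg_invn_powR => //; rewrite subr_gt0.
Qed.

(** * Decomposition and rate of the mean integrated squared error *)

Theorem theorem3p3 (R : realType) (M : nat) (hM : (1 <= M)%N)
    (nrm : 'rV[R]_M -> R) (hnrm : is_norm nrm)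
    (d : measure_display) (T : measurableType d) (P : probability T R)
    (K : R -> R) (hK : kernel_assumptions K)
    (p : 'I_M -> R -> R) (hp : forall m, density_assumptions (p m))
    (N : nat -> 'I_M -> nat) (h : nat -> 'I_M -> R)
    (hNh : scaling_assumptions N h)
    (X : forall n (m : 'I_M), 'I_(N n m) -> {RV P >-> R})
    (hX : forall n, (0 < n)%N -> independent_samples p (X n)) :
  let normN n := nrm (\row_i (N n i)%:R) in
  let normh n := nrm (\row_i h n i) in
  let err n := (error_bias K p (h n) (X n) + error_variance K p (h n) (X n))%E in
  [/\ forall n, (0 < n)%N ->
        [/\ AMISE K p (N n) (h n) \is a fin_num,
            error_bias K p (h n) (X n) \is a fin_num,
            error_variance K p (h n) (X n) \is a fin_num &
            MISE K p (h n) (X n) = (AMISE K p (N n) (h n) + err n)%E],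
      (fun n => fine (err n)) =o_\oo
        (fun n => normh n ^+ 4 + (normN n * normh n)^-1) &
      [/\ forall i, h n i @[n --> \oo] --> 0,
          forall i, (N n i)%:R @[n --> \oo] --> (+oo : set_system R) &
          (normN n * normh n)^-1 @[n --> \oo] --> 0]].
Proof.
move=> normN normh err.
have [eta [eps [a [A [c [C [[a0 A0 c0 C0] rates hrate Nrate [eta_0 eps_0]]]]]]]] :=
  scaling_rates hNh.
have h0 n m : (0 < n)%N -> 0 < h n m by exact: scaling_h_gt0 hNh _ _.
have n0' n : (0 < n)%N -> 0 < n%:R :> R by rewrite ltr0n.
have N0 n m : (0 < n)%N -> (0 < N n m)%N.
  move=> n0; rewrite -(ltr0n R); have /andP[+ _] := Nrate n m n0.
  by apply: lt_le_trans; rewrite mulr_gt0// n0'.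
have eta_gt0 n : (0 < n)%N -> 0 < eta n by move=> /rates[/andP[]].
have eps_gt0 n : (0 < n)%N -> 0 < eps n by move=> /rates[_ /andP[]].
have eta01 n : (0 < n)%N -> 0 <= eta n <= 1.
  by move=> /rates[/andP[e0 ->]] _ _; rewrite ltW.
have eps01 n : (0 < n)%N -> 0 <= eps n <= 1.
  by move=> /rates[_ /andP[e0 ->]] _; rewrite ltW.
have epsE n : (0 < n)%N -> eps n = (n%:R * eta n)^-1.
  move=> n0; have [_ _ nE] := rates n n0.
  by rewrite invfM -nE mulfK// gt_eqF// eta_gt0.
have hA n m : (0 < n)%N -> h n m <= A * eta n by move=> n0; case/andP: (hrate n m n0).
have NhE n m : (0 < n)%N ->
    0 <= ((N n m)%:R * h n m)^-1 <= (c * a)^-1 * eps n.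
  move=> n0; have /andP[Nc _] := Nrate n m n0; have /andP[ha _] := hrate n m n0.
  have nE0 : 0 < n%:R * eta n by rewrite mulr_gt0 ?n0' ?eta_gt0.
  rewrite invr_ge0 mulr_ge0 ?ler0n ?(ltW (h0 _ _ n0))//= epsE// -invfM.
  rewrite lef_pV2 ?posrE ?mulr_gt0 ?ltr0n ?N0 ?h0 ?eta_gt0//.
  rewrite (_ : c * a * (n%:R * eta n) = (c * n%:R) * (a * eta n)); last by ring.
  by apply: ler_pM; rewrite // mulr_ge0// ?ler0n// ?(ltW a0) ?(ltW c0)// ltW// eta_gt0.
have [CB HB] := error_bias_rate hK hp h0 eta01 hA.
have [CV HV] := error_variance_rate hK hp h0 eta01 eps01 hA NhE.
have errbE n : (0 < n)%N -> error_bias K p (h n) (X n) =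
    (\int[leb]_x ((phatstar_mean K p (h n) x - pstar p x) ^+ 2)%:E
     - AMISE_bias K p (h n))%E.
  move=> n0; congr (_ - _)%E; apply: eq_integral => x _.
  rewrite (expectation_phatstar hK hp (N0 n ^~ n0) (h0 n ^~ n0) (hX n n0)).
  by rewrite -EFinB EFin_expe.
have errvE n : (0 < n)%N -> error_variance K p (h n) (X n) =
    (\int[leb]_x (phatstar_variance K p (N n) (h n) x)%:E
     - AMISE_variance K p (N n) (h n))%E.
  move=> n0; congr (_ - _)%E; apply: eq_integral => x _.
  by rewrite (variance_phatstar hK hp (N0 n ^~ n0) (h0 n ^~ n0) (hX n n0)).
have [cn cn0 ncn] := is_norm_ge_sup hnrm hM.
have [Cn Cn0 nCn] := is_norm_le_sup hnrm.
pose i0 : 'I_M := Ordinal hM.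
have normh_ge n : (0 < n)%N -> cn * a * eta n <= normh n.
  move=> n0; apply: le_trans (ncn _ i0); rewrite mxE gtr0_norm ?h0// -mulrA.
  by rewrite ler_wpM2l ?(ltW cn0)//; case/andP: (hrate n i0 n0).
have normh_le n : (0 < n)%N -> normh n <= Cn * (A * eta n).
  move=> n0; apply: nCn => [|i].
    by rewrite mulr_ge0 ?(ltW A0) ?(ltW (eta_gt0 _ n0)).
  by rewrite mxE gtr0_norm ?h0// hA.
have normN_ge n : (0 < n)%N -> cn * c * n%:R <= normN n.
  move=> n0; apply: le_trans (ncn _ i0); rewrite mxE ger0_norm ?ler0n// -mulrA.
  by rewrite ler_wpM2l ?(ltW cn0)//; case/andP: (Nrate n i0 n0).
have normN_le n : (0 < n)%N -> normN n <= Cn * (C * n%:R).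
  move=> n0; apply: nCn => [|i]; first by rewrite mulr_ge0 ?(ltW C0) ?ler0n.
  by rewrite mxE ger0_norm ?ler0n//; case/andP: (Nrate n i n0).
have normh0 n : (0 < n)%N -> 0 < normh n.
  by move=> n0; apply: lt_le_trans (normh_ge n n0); rewrite !mulr_gt0 ?eta_gt0.
have normN0 n : (0 < n)%N -> 0 < normN n.
  by move=> n0; apply: lt_le_trans (normN_ge n n0); rewrite !mulr_gt0 ?n0'.
pose k1 := (Cn * C * (Cn * A))^-1; pose k2 := (cn * c * (cn * a))^-1.
have k10 : 0 < k1 by rewrite invr_gt0 !mulr_gt0.
have k20 : 0 < k2 by rewrite invr_gt0 !mulr_gt0.
have prod_ge n : (0 < n)%N -> k1 * eps n <= (normN n * normh n)^-1.
  move=> n0; rewrite epsE// -invfM.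
  rewrite lef_pV2 ?posrE ?mulr_gt0 ?n0' ?eta_gt0 ?normh0 ?normN0//.
  rewrite (_ : _ * (n%:R * eta n) = Cn * (C * n%:R) * (Cn * (A * eta n))); last by ring.
  by apply: ler_pM; rewrite ?normN_le ?normh_le// ltW ?normh0 ?normN0.
have prod_le n : (0 < n)%N -> (normN n * normh n)^-1 <= k2 * eps n.
  move=> n0; rewrite epsE// -invfM.
  rewrite lef_pV2 ?posrE ?mulr_gt0 ?n0' ?eta_gt0 ?normh0 ?normN0//.
  rewrite (_ : _ * (n%:R * eta n) = cn * c * n%:R * (cn * a * eta n)); last by ring.
  by apply: ler_pM; rewrite ?normN_ge ?normh_ge// !mulr_ge0 ?ler0n ?(ltW cn0) ?(ltW c0)
    ?(ltW a0) ?(ltW (eta_gt0 _ n0)).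
split.
- move=> n n0; have [fIB fAB _] := HB n n0; have [mV fIV fAV _] := HV n n0.
  have finB (x y : \bar R) : x \is a fin_num -> y \is a fin_num ->
      (x - y)%E \is a fin_num by rewrite fin_numB => -> ->.
  rewrite /err errbE// errvE//; split; [|exact: finB|exact: finB|].
    by rewrite /AMISE fin_numD fAB.
  rewrite (MISE_bias_variance hK hp (N0 n ^~ n0) (h0 n ^~ n0) (hX n n0) mV).
  rewrite /AMISE -(fineK fIB) -(fineK fAB) -(fineK fIV) -(fineK fAV).
  by rewrite -!EFinB -!EFinD; congr EFin; ring.
- apply/eqoP => e e0.
  (* With eta <= d1 and eta, eps <= d2, the bias and variance bounds are at
     most e times the lower bounds (cn a eta)^4 and k1 eps of the two
     comparison terms. *)
  pose d1 := e * (cn * a) ^+ 4 / (`|CB| + 1).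
  pose d2 := e * k1 / (2 * (`|CV| + 1)).
  have cb0 : 0 < `|CB| + 1 by rewrite ltr_wpDl.
  have cv0 : 0 < `|CV| + 1 by rewrite ltr_wpDl.
  have d10 : 0 < d1 by rewrite divr_gt0// mulr_gt0// exprn_gt0// mulr_gt0.
  have d20 : 0 < d2 by rewrite divr_gt0// mulr_gt0.
  near=> n.
  have n0 : (0 < n)%N by near: n; exact: nbhs_infty_gt.
  have e1 : eta n <= d1.
    rewrite -(gtr0_norm (eta_gt0 n n0)); near: n.
    by move/cvgr0_norm_le : eta_0; apply.
  have e2 : eta n <= d2.
    rewrite -(gtr0_norm (eta_gt0 n n0)); near: n.
    by move/cvgr0_norm_le : eta_0; apply.
  have e3 : eps n <= d2.
    rewrite -(gtr0_norm (eps_gt0 n n0)); near: n.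
    by move/cvgr0_norm_le : eps_0; apply.
  have et0 := eta_gt0 n n0; have ep0 := eps_gt0 n n0.
  have [fIB fAB HBn] := HB n n0; have [mV fIV fAV HVn] := HV n n0.
  rewrite /err errbE// errvE// fineD; [|by rewrite fin_numB fIB|by rewrite fin_numB fIV].
  apply: (le_trans (ler_normD _ _)); apply: (le_trans (lerD HBn HVn)).
  rewrite [leRHS](_ : _ = e * normh n ^+ 4 + e * (normN n * normh n)^-1); last first.
    rewrite ger0_norm ?mulrDr// addr_ge0 ?exprn_ge0 ?invr_ge0 ?mulr_ge0//;
      by rewrite ltW ?normh0 ?normN0.
  apply: lerD.
  + apply: (@le_trans _ _ ((`|CB| + 1) * d1 * eta n ^+ 4)).
      rewrite exprS mulrA ler_wpM2r ?exprn_ge0 ?(ltW et0)//.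
      apply: (@le_trans _ _ ((`|CB| + 1) * eta n)); last by rewrite ler_wpM2l ?(ltW cb0).
      by rewrite ler_wpM2r ?(ltW et0)// (le_trans (ler_norm _))// lerDl.
    have -> : (`|CB| + 1) * d1 = e * (cn * a) ^+ 4.
      by rewrite /d1 mulrC divfK// gt_eqF.
    rewrite -mulrA -exprMn ler_wpM2l ?(ltW e0)//.
    rewrite lerXn2r ?nnegrE ?normh_ge// ?(ltW (normh0 _ n0))//.
    by rewrite !mulr_ge0 ?(ltW et0) ?(ltW cn0) ?(ltW a0).
  + apply: (@le_trans _ _ ((`|CV| + 1) * (2 * d2) * eps n)).
      rewrite mulrCA mulrC ler_wpM2r ?(ltW ep0)//.
      apply: (@le_trans _ _ ((`|CV| + 1) * (eps n + eta n))).
        rewrite ler_wpM2r ?addr_ge0 ?(ltW ep0) ?(ltW et0)//.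
        by rewrite (le_trans (ler_norm _))// lerDl.
      by rewrite ler_wpM2l ?(ltW cv0)//; lra.
    rewrite (_ : (`|CV| + 1) * (2 * d2) = e * k1); last first.
      by rewrite /d2; field; rewrite gt_eqF.
    by rewrite -mulrA ler_wpM2l ?(ltW e0)// prod_ge.
- split.
  + move=> i; apply/cvgr0Pnorm_le => e e0; near=> n.
    have n0 : (0 < n)%N by near: n; exact: nbhs_infty_gt.
    rewrite gtr0_norm ?h0//; apply: (le_trans (hA n i n0)).
    rewrite mulrC -ler_pdivlMr// -(gtr0_norm (eta_gt0 n n0)); near: n.
    by move/cvgr0_norm_le : eta_0; apply; rewrite divr_gt0.
  + move=> i; apply/cvgryPge => B; near=> n.
    have n0 : (0 < n)%N by near: n; exact: nbhs_infty_gt.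
    have /andP[+ _] := Nrate n i n0; apply: le_trans.
    rewrite mulrC -ler_pdivrMr//; near: n; exact: nbhs_infty_ger.
  + apply/cvgr0Pnorm_le => e e0; near=> n.
    have n0 : (0 < n)%N by near: n; exact: nbhs_infty_gt.
    rewrite ger0_norm ?invr_ge0 ?mulr_ge0 ?(ltW (normN0 _ n0)) ?(ltW (normh0 _ n0))//.
    apply: (le_trans (prod_le n n0)).
    rewrite mulrC -ler_pdivlMr// -(gtr0_norm (eps_gt0 n n0)); near: n.
    by move/cvgr0_norm_le : eps_0; apply; rewrite divr_gt0.
Unshelve. all: by end_near. Qed.
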